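(* For every integer $t$ with $2\le t\le 31$, $D(t)=\lceil\log_2 t\rceil$, whereas $D(32)=6$.
   Context: For a finite tree $T$ (with unit edge lengths), $\dim_\infty(T)$ is the least $m$ for which its path metric (the graph distance on its vertices) embeds isometrically into $(\mathbb{R}^m,\|\cdot\|_\infty)$, where $\|\cdot\|_\infty$ is the maximum norm. A leaf is a vertex of degree one. For $t\ge 2$, $D(t)=\max\{\dim_\infty(T): T\text{ is a finite tree with exactly }t\text{ leaves}\}$. *)

(* Defs.v *)
From HB Require Import structures.
From mathcomp Require Import all_boot all_order all_algebra.
From mathcomp Require Import boolp reals topology normedtype.

Set Implicit Arguments.
Unset Strict Implicit.
Unset Printing Implicit Defensive.

Import Order.TTheory GRing.Theory Num.Theory.
Import numFieldNormedType.Exports.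

Local Open Scope ring_scope.

Record tree := Tree {
  vert :> finType;
  adj : rel vert;
  adj_sym : symmetric adj;
  adj_irr : irreflexive adj;
  tree_nonempty : (0 < #|vert|)%N;
  tree_connected : forall x y : vert, connect adj x y;
  (* every edge [:: x; y] is itself an adj-cycle, whence the bound 2 *)
  tree_acyclic : forall c : seq vert, ucycle adj c -> (size c <= 2)%N }.

Definition nleaves (T : tree) : nat :=
  #|[set x : T | #|[set y : T | adj x y]| == 1%N]|.

Definition walk (T : tree) (x y : T) (n : nat) : bool :=
  [exists p : n.-tuple T, path (@adj T) x p && (last x p == y)].

Lemma walkP (T : tree) (x y : T) n :
  reflect (exists p : seq T, [/\ path (@adj T) x p, last x p = y & size p = n])
          (walk x y n).
Proof.
apply: (iffP existsP) => [[p /andP[xp /eqP py]]|[p [xp py /eqP sp]]].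
  by exists p; rewrite size_tuple.
by exists (Tuple sp); rewrite /= xp py eqxx.
Qed.

Lemma walk_exists (T : tree) (x y : T) : exists n, walk x y n.
Proof.
have /connectP[p xp yE] := tree_connected x y.
by exists (size p); apply/walkP; exists p.
Qed.

Definition tdist (T : tree) (x y : T) : nat := ex_minn (walk_exists x y).

Lemma tdist_walk (T : tree) (x y : T) : walk x y (tdist x y).
Proof. by rewrite /tdist; case: ex_minnP. Qed.

Lemma tdist_le (T : tree) (x y : T) n : walk x y n -> (tdist x y <= n)%N.
Proof. by rewrite /tdist; case: ex_minnP => m _; apply. Qed.

Lemma tdistxx (T : tree) (x : T) : tdist x x = 0%N.
Proof. by apply/eqP; rewrite -leqn0 tdist_le//; apply/walkP; exists [::]. Qed.

Lemma tdist_triangle (T : tree) (y x z : T) :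
  (tdist x z <= tdist x y + tdist y z)%N.
Proof.
have /walkP[p [xp py <-]] := tdist_walk x y.
have /walkP[q [yq qz <-]] := tdist_walk y z.
apply/tdist_le/walkP; exists (p ++ q).
by rewrite cat_path last_cat size_cat py xp yq qz.
Qed.

Lemma tdist_sym (T : tree) (x y : T) : tdist x y = tdist y x.
Proof.
suff le (u v : T) : (tdist u v <= tdist v u)%N by apply/eqP; rewrite eqn_leq !le.
have /walkP[p [vp pu <-]] := tdist_walk v u.
apply/tdist_le/walkP; exists (rev (belast v p)).
rewrite -pu rev_path size_rev size_belast; split=> //.
  by rewrite (eq_path (e' := @adj T))// => a b; rewrite adj_sym.
by case: p {vp pu} => //= a p; rewrite rev_cons last_rcons.
Qed.

(* The library norm of 'rV[R]_m is the maximum norm (mx_normrE). *)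
Definition linfty_embeds (R : realType) (T : tree) (m : nat) : Prop :=
  exists f : T -> 'rV[R]_m, forall x y : T, `|f x - f y| = (tdist x y)%:R.

Lemma linfty_embeds_exists (R : realType) (T : tree) :
  exists m, `[< linfty_embeds R T m >].
Proof.
exists #|T|; apply/asboolP.
exists (fun x => \row_i (tdist x (enum_val i))%:R) => x y.
rewrite [LHS]mx_normrE; apply/eqP; rewrite eq_le; apply/andP; split.
  apply: bigmax_le => // -[i j] _; rewrite !mxE/= ler_norml; apply/andP; split.
    rewrite lerNl opprB lerBlDr -natrD ler_nat (tdist_sym x y).
    exact: tdist_triangle.
  by rewrite lerBlDr -natrD ler_nat tdist_triangle.
apply/bigmax_geP; right => /=; exists (ord0, enum_rank y) => //.
by rewrite !mxE/= enum_rankK tdistxx subr0 normr_nat.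
Qed.

Definition dim_infty (R : realType) (T : tree) : nat :=
  ex_minn (linfty_embeds_exists R T).

(* is_D R t d : the maximum D(t) exists and equals d. *)
Definition is_D (R : realType) (t d : nat) : Prop :=
  (exists T : tree, nleaves T = t /\ dim_infty R T = d) /\
  (forall T : tree, nleaves T = t -> (dim_infty R T <= d)%N).

(* Main.v *)
From Stdlib Require Import NArith.
Require Import Defs.
From mathcomp Require Import all_boot reals.
From mathcomp Require Import all_order all_algebra.
From mathcomp Require Import boolp topology normedtype.
From mathcomp Require Import lra zify.

Set Implicit Arguments.
Unset Strict Implicit.
Unset Printing Implicit Defensive.

Import Order.TTheory GRing.Theory Num.Theory.

(** Orient every edge of a tree [T] once for each of [m] coordinates. Summing
    the resulting signs along paths gives [m] functions that change by one along
    each edge; together they embed [T] isometrically in dimension [m] as soon as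
    every path is consistently oriented for some coordinate
    ([embeds_of_signs]). Conversely, the coordinates of an embedding orient the
    edges by increase, and every path between leaves is consistently oriented
    for some coordinate. Labelling a leaf by the signs of its edge, oriented away
    from it, maps the leaves to points of the cube [{0, 1} ^ m]. For every edge
    with sign vector [s] and all leaves [a] and [b] on its two sides, there is a
    coordinate in which the label of [a] agrees with [s] and the label of [b]
    does not ([embeds_separating]).

    Lower bound. Distinct leaves have distinct labels, so [t <= 2 ^ m]
    ([nleaves_le_exp]), and a star with [t] leaves gives [D(t) >= log_2 t]. If
    [t = 2 ^ m], all points of the cube are labels, and the set of the labels on
    one side of an edge is unate: in each coordinate it is closed either under
    increasing or under decreasing it ([unate_label_mask]). In particular the
    labels of the leaves of a pendant complete binary tree of depth at most 3
    form a subcube.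
    Consider the caterpillar with 32 leaves whose spine carries successively a
    leaf, complete binary trees of depths 2, 3, 2, 3, and 7 leaves. Its initial
    parts would give disjoint subcubes of dimensions 0, 2, 3, 2, 3 of the 5-cube
    whose successive unions are unate, and a finite search ([search_fails])
    shows that there are none.

    Upper bound. Let [I_k] be the set of the points of the cube that represent
    the numbers less than [k] in binary; it is closed under clearing
    coordinates, hence star-shaped about 0. For [k + k' <= 16] the set
    [I_(k + k')] is the disjoint union of a copy of [I_k] and a copy of [I_k'],
    copies being taken under the automorphisms of the cube ([split_okP]). In a
    rooted tree in which at most [k <= 16] leaves lie beyond an edge, such
    copies can therefore be assigned to all edges beyond it, with disjoint
    copies for siblings, each inside the copy of the parent edge. Let the sign
    vector of an edge be the centre of its copy. Along a path towards the root,
    all the points whose coordinates are taken from the signs met so far remain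
    in the current copy because it is star-shaped ([chain_inside]). Two paths
    arriving through siblings thus have opposite constant signs in some
    coordinate, the two copies being disjoint ([chains_opposite]). For
    [t <= 16] the root is a leaf. For [17 <= t <= 31] it is a centroid, whose
    branches form three groups of at most 15 leaves each, and disjoint copies of
    [I_a], [I_b], [I_c] with [a + b + c = 31] are found in the 5-cube
    ([packing31]). For [t = 32] three disjoint copies of [I_16] in the 6-cube
    suffice. *)

(** * The metric of a tree *)

Section Metric.
Variable T : tree.
Implicit Types x y z u v w c : T.

Lemma adj_neq x y : adj x y -> x != y.
Proof. by apply: contraTneq => ->; rewrite adj_irr. Qed.

Lemma tdist_eq0 x y : (tdist x y == 0) = (x == y).
Proof.
apply/eqP/eqP => [|->]; last exact: tdistxx.
by move=> d0; have := tdist_walk x y; rewrite d0 => /walkP[[|a p] []] /=.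
Qed.

Lemma tdist_adj x y : adj x y -> tdist x y = 1.
Proof.
move=> xy; apply/eqP; rewrite eqn_leq lt0n tdist_eq0 adj_neq// andbT.
by apply/tdist_le/walkP; exists [:: y]; rewrite /= xy.
Qed.

Lemma tdist_adj_le x y z : adj x y -> tdist x z <= (tdist y z).+1.
Proof. by move=> xy; rewrite -add1n -(tdist_adj xy) tdist_triangle. Qed.

Lemma closer_exists x z : x != z -> exists2 y, adj x y & tdist x z = (tdist y z).+1.
Proof.
move=> xz; have /walkP[[|y p] [xp pz sp]] := tdist_walk x z.
  by rewrite -pz eqxx in xz.
move: xp => /= /andP[xy yp]; exists y => //.
apply/eqP; rewrite eqn_leq tdist_adj_le// -sp /= ltnS.
by apply/tdist_le/walkP; exists p.
Qed.

(** Every edge of a tree is a bridge. *)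
Lemma edge_bridge x y : adj x y ->
  ~~ connect [rel a b | adj a b && ((a, b) \notin [:: (x, y); (y, x)])] x y.
Proof.
move=> xy; apply/negP => /connectP[p0 p0x yE].
move: yE; case/shortenP: p0x => p xp up _ yE.
have Axp : path (@adj T) x p.
  by apply: sub_path xp => a b /= /andP[].
have szp : 1 < size p.
  case: p xp up yE {Axp} => [|a [|b p]] //=.
    by move=> _ _ yx; move: xy; rewrite yx adj_irr.
  by rewrite !inE andbT => /andP[_ +] _ ya; rewrite ya eqxx.
have := @tree_acyclic T (x :: p); rewrite /ucycle /= => /(_ _)/=.
rewrite leqNgt ltnS szp => /(_ _) H; apply: notF; apply: H.
by rewrite rcons_path Axp -yE adj_sym xy; apply/andP.
Qed.

(** Vertices closer to [z] than [x] reach [z] without using the edges at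
    [x]. *)
Lemma connect_closer x y z v : tdist v z < tdist x z ->
  connect [rel a b | adj a b && ((a, b) \notin [:: (x, y); (y, x)])] v z.
Proof.
have [n] := ubnP (tdist v z); elim: n v => // n IHn v; rewrite ltnS => vn vx.
have [->|vz] := eqVneq v z; first exact: connect0.
have [w vw dv] := closer_exists vz.
have dw : tdist w z < tdist x z by apply: leq_trans vx; rewrite dv.
apply: connect_trans (IHn w _ dw); last by rewrite -dv.
apply: connect1; rewrite /= vw /= !inE !xpair_eqE !negb_or !negb_and.
have -> : v != x by apply: contraTneq vx => ->; rewrite ltnn.
by have -> : w != x by [apply: contraTneq dw => ->; rewrite ltnn]; rewrite orbT.
Qed.

Lemma bridge_sym x y :
  connect_sym [rel a b : T | adj a b && ((a, b) \notin [:: (x, y); (y, x)])].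
Proof.
apply: sym_connect_sym => a b /=; rewrite adj_sym !inE !xpair_eqE; congr andb.
by rewrite orbC (andbC (b == y)) (andbC (b == x)).
Qed.

Lemma tdist_adj_neq x y z : adj x y -> tdist x z != tdist y z.
Proof.
move=> xy; apply/eqP => dxy.
have xz : x != z.
  apply: contraTneq xy => xz; move/eqP: dxy; rewrite xz tdistxx eq_sym tdist_eq0.
  by move/eqP ->; rewrite adj_irr.
have yz : y != z.
  by rewrite -tdist_eq0 -dxy tdist_eq0.
have [x1 xx1 dx1] := closer_exists xz.
have [y1 yy1 dy1] := closer_exists yz.
have /negP := edge_bridge xy; apply.
have x1y : x1 != y.
  by apply/eqP => E; move: dx1; rewrite E -dxy => /eqP; rewrite eqn_leq ltnn andbF.
have y1x : y1 != x.
  by apply/eqP => E; move: dy1; rewrite E dxy => /eqP; rewrite eqn_leq ltnn andbF.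
apply: (@connect_trans _ _ z).
  apply: connect_trans (connect_closer y (v := x1) _); last by rewrite dx1.
  by apply: connect1; rewrite /= xx1 !inE !xpair_eqE (negPf x1y) (negPf (adj_neq xy)) andbF.
rewrite bridge_sym.
apply: connect_trans (connect_closer y (v := y1) _); last by rewrite dxy dy1.
apply: connect1.
by rewrite /= yy1 !inE !xpair_eqE (negPf y1x) eq_sym (negPf (adj_neq xy)) andbF.
Qed.

Lemma closer_unique x y y' z : adj x y -> adj x y' ->
  tdist y z < tdist x z -> tdist y' z < tdist x z -> y = y'.
Proof.
move=> xy xy' dy dy'; apply/eqP/negPn/negP => yy'.
have /negP := edge_bridge xy; apply.
apply: (@connect_trans _ _ z); last by rewrite bridge_sym connect_closer.
apply: connect_trans (connect_closer y dy').
apply: connect1; rewrite /= xy' !inE !xpair_eqE eq_sym (negPf yy').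
by rewrite (negPf (adj_neq xy)) andbF.
Qed.

Lemma tdist_adj_lt x y z : adj x y ->
  tdist x z = (tdist y z).+1 \/ tdist y z = (tdist x z).+1.
Proof.
move=> xy; have := tdist_adj_neq z xy; have := tdist_adj_le z xy.
move: (xy); rewrite adj_sym => /(tdist_adj_le z).
case: (ltngtP (tdist x z) (tdist y z)) => // H A B _; [right|left];
  by apply/eqP; rewrite eqn_leq A H || rewrite eqn_leq B H.
Qed.

(** A path between the two sides of a cut consisting of one edge uses that
    edge. *)
Lemma tdist_cut (S : pred T) u v a b :
  (forall x y, adj x y -> S x -> ~~ S y -> x = u /\ y = v) ->
  S a -> ~~ S b -> tdist a b = (tdist a u + (tdist v b).+1).
Proof.
move=> cut Sa Sb; apply/eqP; rewrite eqn_leq; apply/andP; split; last first.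
  have /walkP[p [ap pb <-]] := tdist_walk a b.
  elim: p a Sa ap pb => [|c p IHp] a Sa /=; first by move=> _ E; rewrite -E Sa in Sb.
  move=> /andP[ac cp] pb; case Sc: (S c).
    apply: (@leq_trans (tdist c u + (tdist v b).+1).+1).
      by rewrite -addSn leq_add2r tdist_adj_le.
    by rewrite ltnS (IHp _ Sc cp pb).
  have [-> <-] := cut _ _ ac Sa (negbT Sc).
  by rewrite tdistxx add0n ltnS; apply/tdist_le/walkP; exists p.
have [y [x [xy Sx Sy]]] : exists y x, [/\ adj x y, S x & ~~ S y].
  have /walkP[p [ap pb _]] := tdist_walk a b.
  elim: p a Sa ap pb => [|c p IHp] a Sa /=; first by move=> _ E; rewrite -E Sa in Sb.
  move=> /andP[ac cp] pb; case Sc: (S c); first exact: (IHp c).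
  by exists c, a; rewrite ac Sa Sc.
have [xu yv] := cut _ _ xy Sx Sy; rewrite xu yv in xy.
apply: leq_trans (tdist_triangle u a b) _; rewrite leq_add2l.
by rewrite tdist_adj_le.
Qed.

End Metric.

(** * Branches and centroids *)

Section Branches.
Variable T : tree.
Implicit Types x y z u v w c : T.

Definition leaves : {set T} := [set x : T | #|[set y : T | adj x y]| == 1].

(** The branch of [y] at a neighbour [x]: the vertices on the [y] side of the
    edge joining [x] and [y]. *)
Definition branch x y : {set T} := [set z | tdist y z < tdist x z].

(** Number of leaves of the tree in a branch. *)
Definition weight x y : nat := #|leaves :&: branch x y|.

Lemma branchC x y : adj x y -> branch y x = ~: branch x y.
Proof.
move=> xy; apply/setP => z; rewrite !inE -leqNgt.
by have := tdist_adj_neq z xy; case: ltngtP.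
Qed.

Lemma branch_head x y : adj x y -> y \in branch x y.
Proof. by move=> xy; rewrite inE tdistxx lt0n tdist_eq0 adj_neq. Qed.

Lemma branch_sub x y c : adj x y -> adj y c -> c != x ->
  branch y c \subset branch x y :\ y.
Proof.
move=> xy yc cx; apply/subsetP => z; rewrite !inE => cz.
rewrite (contraTneq _ cz) /=; last by move=> ->; rewrite tdistxx.
have yx : adj y x by rewrite adj_sym.
case: (tdist_adj_lt z xy) => [->//|H].
by move: cx; rewrite (closer_unique yc yx cz) ?eqxx// H.
Qed.

Lemma branch_disjoint y c c' : adj y c -> adj y c' -> c != c' ->
  [disjoint branch y c & branch y c'].
Proof.
move=> yc yc' cc'; rewrite -setI_eq0; apply/eqP/setP => z; rewrite !inE.
by apply/negP => /andP[cz cz']; rewrite (closer_unique yc yc' cz cz') eqxx in cc'.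
Qed.

Lemma weightC x y : adj x y -> weight x y + weight y x = nleaves T.
Proof.
by move=> xy; rewrite /weight (branchC xy) -setDE cardsID /nleaves /leaves.
Qed.

(** The vertex of a branch farthest from its root is a leaf. *)
Lemma weight_gt0 x y : adj x y -> 0 < weight x y.
Proof.
move=> xy; have hy := branch_head xy.
case: (@arg_maxnP _ y (mem (branch x y)) (fun z => tdist x z) hy) => z zB0 zmax.
have zB : z \in branch x y := zB0.
apply/card_gt0P; exists z; rewrite inE zB andbT inE.
have xz : z != x by apply: contraTneq zB => ->; rewrite inE tdistxx.
have [w zw dw] := closer_exists xz.
apply/cards1P; exists w; apply/setP => v; rewrite !inE.
apply/idP/eqP => [zv|->//].
apply: (@closer_unique _ _ _ _ x zv zw); last by rewrite dw.
case: (tdist_adj_lt x zv) => [->//|dv].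
have : v \in branch x y -> tdist x v <= tdist x z := zmax v; rewrite inE.
move: zB; rewrite inE => zB.
have dyv : tdist y v <= (tdist y z).+1.
  by rewrite (tdist_sym y v) (tdist_sym y z) tdist_adj_le// adj_sym.
rewrite (tdist_sym x v) dv (tdist_sym z x) ltnn.
by rewrite (leq_ltn_trans dyv)// => /(_ isT).
Qed.

(** Distinct branches at [x] are disjoint, so their weights add up. *)
Lemma sum_weight_le (cs : seq T) x (B : {set T}) :
  uniq cs -> (forall c, c \in cs -> adj x c /\ branch x c \subset B) ->
  \sum_(c <- cs) weight x c <= #|leaves :&: B|.
Proof.
elim: cs B => [|c cs IHcs] B; first by rewrite big_nil.
move=> /= /andP[cNcs ucs] H; rewrite big_cons.
have [xc cB] := H c (mem_head _ _).
rewrite -(cardsID (branch x c) (leaves :&: B)) leq_add//.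
  by rewrite -setIA (setIidPr cB).
rewrite -setIDA; apply: IHcs => // c' c'cs.
have [xc' c'B] := H c' (mem_behead (s := c :: cs) c'cs); split=> //.
rewrite subsetD c'B; apply: branch_disjoint => //.
by apply: contraNneq cNcs => <-.
Qed.

Lemma sum_weight_branch (cs : seq T) x y : adj x y -> uniq cs ->
  (forall c, c \in cs -> adj y c && (c != x)) ->
  \sum_(c <- cs) weight y c <= weight x y.
Proof.
move=> xy ucs H; apply: sum_weight_le => // c /H /andP[yc cx]; split=> //.
by apply: subset_trans (branch_sub xy yc cx) _; rewrite subsetDl.
Qed.

(** A leaf does not belong to its own branch. *)
Lemma sum_weight_all (cs : seq T) x : uniq cs ->
  (forall c, c \in cs -> adj x c) ->
  \sum_(c <- cs) weight x c <= nleaves T - (x \in leaves).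
Proof.
move=> ucs H; apply: (@leq_trans #|leaves :&: [set~ x]|).
  apply: sum_weight_le => // c /H xc; split=> //.
  by apply/subsetP => z; rewrite !inE; apply: contraTneq => ->; rewrite tdistxx.
by rewrite /nleaves -/leaves (cardsD1 x leaves) addKn setIC setDE setIC.
Qed.

(** A tree with at most [2 H + 1] leaves has a vertex all of whose branches
    have at most [H] leaves. *)
Lemma centroid H : nleaves T <= H.*2.+1 ->
  exists x, forall y, adj x y -> weight x y <= H.
Proof.
move=> tH; have [/existsP[x /forallP xP]|] :=
  boolP [exists x : T, [forall y, adj x y ==> (weight x y <= H)]].
  by exists x => y xy; have /implyP := xP y; apply.
rewrite negb_exists => /forallP noc.
have big x : exists2 y, adj x y & H < weight x y.
  have := noc x; rewrite negb_forall => /existsP[y]; rewrite negb_imply -ltnNge.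
  by case/andP; exists y.
pose P (e : T * T) := adj e.1 e.2 && (H < weight e.1 e.2).
have [x0 _] := card_gt0P (tree_nonempty T).
have [y0 xy0 wxy0] := big x0.
have P0 : P (x0, y0) by rewrite /P /= xy0.
case: (arg_minnP (fun e : T * T => #|branch e.1 e.2|) P0) => -[x y] /andP[/= xy wxy] mn.
(* the heavy branch at [y] is strictly smaller than the one at [x] *)
have [z yz wyz] := big y.
have zx : z != x.
  apply: contraTneq wyz => ->; rewrite -leqNgt -ltnS -(ltn_add2l (weight x y)).
  rewrite (weightC xy); apply: leq_ltn_trans tH _.
  by rewrite -addnn -addSn -addnS leq_add2r.
have := mn (y, z); rewrite /P /= yz wyz => /(_ isT); rewrite leqNgt => /negP[].
apply: leq_ltn_trans (subset_leq_card (branch_sub xy yz zx)) _.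
by rewrite [X in _ < X](cardsD1 y) branch_head.
Qed.

End Branches.

(** * Embeddings from orientations *)

Section Parent.
Variable (T : tree) (r : T).
Implicit Types x y z u v w c : T.

(** The neighbour of [x] on the way to the root [r], and [r] for [x = r]. *)
Definition parent x : T :=
  odflt r [pick y | adj x y && (tdist y r < tdist x r)].

Lemma parentP x : x != r ->
  adj x (parent x) /\ tdist x r = (tdist (parent x) r).+1.
Proof.
move=> xr; rewrite /parent; case: pickP => [y /andP[xy]|/=].
  by case: (tdist_adj_lt r xy) => -> //; rewrite ltnNge leqnSn.
by have [y xy ->] := closer_exists xr => /(_ y); rewrite xy ltnS leqnn.
Qed.

Lemma adj_parent x y : adj x y ->
  (x != r /\ parent x = y) \/ (y != r /\ parent y = x).
Proof.
wlog: x y / tdist x r = (tdist y r).+1.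
  move=> W xy; case: (tdist_adj_lt r xy) => d; first exact: W.
  by case: (W y x) => //; [rewrite adj_sym|right|left].
move=> d xy; left; have xr : x != r by rewrite -tdist_eq0 d.
have [xp dp] := parentP xr; split=> //.
by apply: (closer_unique xp xy (z := r)); rewrite ?dp ?d// -dp d.
Qed.

Lemma tdist_iter_parent x n : tdist x (iter n parent x) <= n.
Proof.
elim: n => [|n IHn] /=; first by rewrite tdistxx.
apply: leq_trans (tdist_triangle (iter n parent x) _ _) _.
rewrite -addn1 leq_add//.
have [->|nr] := eqVneq (iter n parent x) r.
  rewrite /parent; case: pickP => [y /andP[ry _]|]; first by rewrite tdist_adj.
  by rewrite tdistxx.
by rewrite tdist_adj//; case: (parentP nr).
Qed.

Lemma iter_parent_root x : iter (tdist x r) parent x = r.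
Proof.
move d : (tdist x r) => n; elim: n x d => [|n IHn] x d.
  by apply/eqP; rewrite -tdist_eq0 d.
have xr : x != r by rewrite -tdist_eq0 d.
rewrite iterSr IHn//.
by have [_] := parentP xr; rewrite d => -[].
Qed.

End Parent.

Local Open Scope ring_scope.

(** Orienting the edge between [x] and its parent by the signs [sg i x], one
    orientation for each coordinate [i], embeds the tree as soon as every path
    is consistently oriented for some coordinate: the way up from [v] to a common
    ancestor has a constant sign, and the way up from [w] the opposite one. *)
Lemma embeds_of_signs (R : realType) (T : tree) (r : T) (m : nat)
    (sg : 'I_m -> T -> bool) :
  (forall v w : T, v != w -> exists i b j k,
     [/\ iter j (parent r) v = iter k (parent r) w,
         forall n, (n < j)%N ->
           iter n (parent r) v != r /\ sg i (iter n (parent r) v) = b &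
         forall n, (n < k)%N ->
           iter n (parent r) w != r /\ sg i (iter n (parent r) w) = ~~ b]) ->
  linfty_embeds R T m.
Proof.
move=> cover; pose p := parent r.
pose phi i v : R := \sum_(n < tdist v r) (-1) ^+ sg i (iter n p v).
have phiE i v : v != r -> phi i v = (-1) ^+ sg i v + phi i (p v).
  move=> vr; rewrite /phi; have [_ ->] := parentP vr; rewrite big_ord_recl /=.
  by congr (_ + _); apply: eq_bigr => n _; rewrite -iterS iterSr.
have phiZ i b v j : (forall n, (n < j)%N ->
    iter n p v != r /\ sg i (iter n p v) = b) ->
    phi i v = j%:R * (-1) ^+ b + phi i (iter j p v).
  elim: j => [|j IHj] H; first by rewrite mul0r add0r.
  rewrite IHj; last by move=> n nj; apply: H; rewrite ltnS ltnW.
  have [jr sj] := H j (ltnSn j).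
  by rewrite (phiE i (iter j p v))// sj addrA -[in RHS]natr1 mulrDl mul1r.
have phi_adj i x y : adj x y -> `|phi i x - phi i y| <= 1.
  have sg1 x' : x' != r -> `|phi i x' - phi i (p x')| <= 1.
    by move=> xr; rewrite phiE// addrK normrX normrN1 expr1n.
  by case/(adj_parent r) => -[xr <-]; [|rewrite distrC]; apply: sg1.
have phi_lip i x y : `|phi i x - phi i y| <= (tdist x y)%:R.
  have /walkP[q [xq qy <-]] := tdist_walk x y.
  elim: q x xq qy => [x _ /= ->|c q IHq x /= /andP[xc cq] qy].
    by rewrite subrr normr0.
  rewrite /= -nat1r; apply: le_trans (ler_distD (phi i c) _ _) _.
  by apply: lerD; [exact: phi_adj|exact: IHq].
exists (fun v => \row_i phi i v) => v w.
rewrite [LHS]mx_normrE; apply/eqP; rewrite eq_le; apply/andP; split.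
  by apply: bigmax_le => // -[i j] _; rewrite !mxE/=.
have [->|vw] := eqVneq v w; first by rewrite tdistxx; apply: bigmax_ge_id.
have [i [b [j [k [jk Hv Hw]]]]] := cover v w vw.
apply/bigmax_geP; right => /=; exists (ord0, i) => //.
rewrite !mxE/= (phiZ i b v j)// (phiZ i (~~ b) w k)// /p jk.
have -> : (-1) ^+ (~~ b) = - (-1) ^+ b :> R by case: (b); rewrite ?opprK.
rewrite mulrN opprD opprK addrACA subrr addr0 -mulrDl -natrD.
rewrite normrM normrX normrN1 expr1n mulr1 normr_nat ler_nat.
apply: leq_trans (tdist_triangle (iter j p v) v w) _.
by rewrite leq_add ?tdist_iter_parent// /p jk tdist_sym tdist_iter_parent.
Qed.

Local Close Scope ring_scope.

(** * Star-shaped regions of the cube *)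

(** Points of the 6-cube are bit sequences of size 6, least significant bit
    first; [pval] is the number they represent. *)
Definition pval (x : seq bool) : nat := foldr (fun (b : bool) n => b + n.*2) 0 x.

(** [y] lies in the smallest subcube containing [x] and [s]. *)
Definition hull (x s y : seq bool) : Prop :=
  forall i, nth false y i = nth false x i \/ nth false y i = nth false s i.

(** All the bit sequences of size [n]. *)
Fixpoint points n : seq (seq bool) :=
  if n is n'.+1 then [seq b :: x | b <- [:: false; true], x <- points n']
  else [:: [::]].

Lemma mem_points n x : (x \in points n) = (size x == n).
Proof.
elim: n x => [|n IHn] [|b x] //=.
  by apply/negbTE; rewrite !mem_cat !negb_or; apply/and3P; split => //; apply/mapP => -[].
rewrite cats0 mem_cat eqSS -IHn; case: b.
  rewrite [X in X || _](_ : _ = false); last by apply/mapP => -[y _ []].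
  by apply/mapP/idP => [[y + [->]]|]; last exists x.
rewrite [X in _ || X](_ : _ = false) ?orbF; last by apply/mapP => -[y _ []].
by apply/mapP/idP => [[y + [->]]|]; last exists x.
Qed.

Lemma pval_le x y : size x = size y ->
  (forall i, nth false y i -> nth false x i) -> pval y <= pval x.
Proof.
elim: x y => [|a x IHx] [|b y] //= [sxy] H.
rewrite leq_add ?leq_double ?IHx//; last by move=> i; apply: (H i.+1).
by case: b H => // H; have /= -> := H 0 isT.
Qed.

(** A number less than [2 ^ m] has no digit 1 from position [m] on. *)
Lemma pval_bit m x i : pval x < 2 ^ m -> m <= i -> nth false x i = false.
Proof.
elim: x m i => [|a x IHx] m i; first by rewrite nth_nil.
rewrite [pval _]/=; case: m => [|m].
  rewrite expn0 ltnS leqn0 addn_eq0 double_eq0 => /andP[a0 x0] _.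
  by case: i => [|i] /=; [case: a a0|rewrite (IHx 0)// (eqP x0)].
case: i => // i H mi /=; apply: (IHx m i _ mi).
by rewrite -ltn_double -(mul2n (2 ^ m)) -expnS; apply: leq_ltn_trans H; rewrite leq_addl.
Qed.

(** An automorphism of the cube acts by permuting and flipping coordinates; it
    is coded by the sequence of pairs (source coordinate, flip). *)
Definition cmap (l : seq (nat * bool)) (x : seq bool) : seq bool :=
  [seq nth false x jf.1 (+) jf.2 | jf <- l].

(** The code of the inverse automorphism. *)
Definition cinv (l : seq (nat * bool)) : seq (nat * bool) :=
  [seq (index j (unzip1 l), (nth (0, false) l (index j (unzip1 l))).2)
  | j <- iota 0 6].

Lemma cmap_hull l x s y : hull x s y -> hull (cmap l x) (cmap l s) (cmap l y).
Proof.
move=> H i; case: (ltnP i (size l)) => il; last first.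
  by left; rewrite !nth_default// size_map.
rewrite !(nth_map (0, false))//.
by case: (H (nth (0, false) l i).1) => ->; [left|right].
Qed.

(** A short notation for the automorphisms of the 6-cube. *)
Definition aut_code := (seq nat * nat)%type.

(** The list gives the first source coordinates, the others being unmoved; the
    binary digits of the number are the flips. *)
Definition aut (c : aut_code) : seq (nat * bool) :=
  [seq (nth i c.1 i, odd (iter i half c.2)) | i <- iota 0 6].

Lemma size_cmap_aut c x : size (cmap (aut c) x) = 6.
Proof. by rewrite !size_map size_iota. Qed.

(** [cinv] does code a right inverse. *)
Definition aut_ok c : bool :=
  all (fun z => cmap (aut c) (cmap (cinv (aut c)) z) == z) (points 6).

(** A copy of the set of the points of value less than [rk S]: the points [x]
    with [rh S x] of value less than [rk S], where [rh S] is an automorphism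
    with inverse [rg S]. *)
Record region := Region {
  rk : nat;
  rh : seq bool -> seq bool;
  rg : seq bool -> seq bool }.

Definition inside (S : region) (x : seq bool) : bool := pval (rh S x) < rk S.

(** The point of the copy that corresponds to 0. *)
Definition center (S : region) : seq bool := rg S (nseq 6 false).

(** The part of being inverse automorphisms that is needed of [rh S] and
    [rg S]. *)
Definition proper_region (S : region) : Prop :=
  [/\ forall x s y, hull x s y -> hull (rh S x) (rh S s) (rh S y),
      forall x, size x = 6 -> size (rh S x) = 6 &
      forall x, size x = 6 -> size (rg S x) = 6 /\ rh S (rg S x) = x].

(** A copy is star-shaped about its centre. *)
Lemma inside_hull S x y : proper_region S -> size x = 6 -> size y = 6 ->
  hull x (center S) y -> inside S x -> inside S y.
Proof.
move=> [Sh Ss Sg] sx sy /Sh H; apply: leq_ltn_trans.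
apply: pval_le; first by rewrite !Ss.
move=> i; case: (H i) => ->//; rewrite /center (Sg _ (size_nseq _ _)).2.
by rewrite nth_nseq if_same.
Qed.

Lemma size_center S : proper_region S -> size (center S) = 6.
Proof. by case=> _ _ /(_ _ (size_nseq 6 false))[]. Qed.

Lemma inside_center S : proper_region S -> 0 < rk S -> inside S (center S).
Proof. by case=> _ _ /(_ _ (size_nseq 6 false))[_ E] k0; rewrite /inside E. Qed.

(** The copy cut out in the coordinates of [S] by the automorphism coded by
    [l]. *)
Definition subregion (k : nat) (l : seq (nat * bool)) (S : region) : region :=
  Region k (cmap l \o rh S) (rg S \o cmap (cinv l)).

Lemma proper_subregion k c S : aut_ok c -> proper_region S ->
  proper_region (subregion k (aut c) S).
Proof.
move=> /allP ok [Sh Ss Sg]; split.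
- by move=> x s y /Sh /(cmap_hull (aut c)).
- by move=> x _; apply: size_cmap_aut.
move=> x sx; have sc : size (cmap (cinv (aut c)) x) = 6.
  by rewrite size_map size_map size_iota.
have [s6 E] := Sg _ sc; split; first exact: s6.
transitivity (cmap (aut c) (cmap (cinv (aut c)) x)); first by rewrite -[in RHS]E.
by apply/eqP/ok; rewrite mem_points sx.
Qed.

(** The points of value less than [k] themselves. *)
Definition idregion (k : nat) : region := Region k id id.

(** The copy of rank [k] given by [c] lies among the points of value less than
    [k']. *)
Definition below (k k' : nat) (c : aut_code) : bool :=
  all (fun z => (pval (cmap (aut c) z) < k) ==> (pval z < k')) (points 6).

(** The copies given by [c] and [c'], of ranks [k] and [k'], are disjoint. *)
Definition apart (k k' : nat) (c c' : aut_code) : bool :=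
  all (fun z => ~~ ((pval (cmap (aut c) z) < k) && (pval (cmap (aut c') z) < k')))
    (points 6).

Lemma below_inside k c S x : proper_region S -> size x = 6 ->
  below k (rk S) c -> inside (subregion k (aut c) S) x -> inside S x.
Proof.
move=> [Sh Ss Sg] sx /allP/(_ (rh S x)); rewrite mem_points Ss// => /(_ isT).
by move=> /implyP.
Qed.

Lemma apart_inside k k' c c' S x : proper_region S -> size x = 6 ->
  apart k k' c c' -> inside (subregion k (aut c) S) x ->
  ~~ inside (subregion k' (aut c') S) x.
Proof.
move=> [Sh Ss Sg] sx /allP/(_ (rh S x)); rewrite mem_points Ss// => /(_ isT).
by rewrite negb_and => /orP[/negPf E|//]; rewrite /inside /= E.
Qed.

(** For [k <= k'] with [k + k' <= 16], automorphisms that place copies of the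
    first [k] and of the first [k'] points disjointly among the first [k + k']. *)
Definition split_table : seq (nat * nat * (aut_code * aut_code)) := [::
  (1, 1, (([::], 1), ([::], 0)));
  (1, 2, (([::], 2), ([::], 0)));
  (1, 3, (([::], 3), ([::], 0)));
  (2, 2, (([::], 2), ([::], 0)));
  (1, 4, (([::], 4), ([::], 0)));
  (2, 3, (([:: 2; 1; 0], 0), ([::], 3)));
  (1, 5, (([::], 5), ([::], 0)));
  (2, 4, (([::], 4), ([::], 0)));
  (3, 3, (([:: 0; 2; 1], 3), ([::], 2)));
  (1, 6, (([::], 6), ([::], 0)));
  (2, 5, (([:: 1; 0], 4), ([::], 1)));
  (3, 4, (([::], 4), ([::], 0)));
  (1, 7, (([::], 7), ([::], 0)));
  (2, 6, (([::], 6), ([::], 0)));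
  (3, 5, (([::], 7), ([::], 0)));
  (4, 4, (([::], 4), ([::], 0)));
  (1, 8, (([::], 8), ([::], 0)));
  (2, 7, (([:: 3; 1; 2; 0], 0), ([::], 7)));
  (3, 6, (([:: 0; 3; 2; 1], 0), ([::], 6)));
  (4, 5, (([::], 4), ([:: 0; 1; 3; 2], 0)));
  (1, 9, (([::], 9), ([::], 0)));
  (2, 8, (([::], 8), ([::], 0)));
  (3, 7, (([:: 0; 3; 2; 1], 3), ([::], 6)));
  (4, 6, (([:: 0; 3; 2; 1], 0), ([::], 6)));
  (5, 5, (([:: 0; 3; 1; 2], 1), ([::], 6)));
  (1, 10, (([::], 10), ([::], 0)));
  (2, 9, (([:: 1; 0], 8), ([::], 1)));
  (3, 8, (([::], 8), ([::], 0)));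
  (4, 7, (([::], 4), ([:: 0; 1; 3; 2], 0)));
  (5, 6, (([:: 0; 3; 1; 2], 2), ([::], 6)));
  (1, 11, (([::], 11), ([::], 0)));
  (2, 10, (([::], 10), ([::], 0)));
  (3, 9, (([::], 11), ([::], 0)));
  (4, 8, (([::], 8), ([::], 0)));
  (5, 7, (([:: 0; 1; 3; 2], 7), ([::], 4)));
  (6, 6, (([:: 0; 1; 3; 2], 6), ([::], 4)));
  (1, 12, (([::], 12), ([::], 0)));
  (2, 11, (([:: 2; 1; 0], 8), ([::], 3)));
  (3, 10, (([:: 0; 2; 1], 8), ([::], 2)));
  (4, 9, (([::], 8), ([::], 4)));
  (5, 8, (([::], 8), ([::], 0)));
  (6, 7, (([:: 0; 3; 2; 1], 8), ([:: 0; 3; 2; 1], 0)));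
  (1, 13, (([::], 13), ([::], 0)));
  (2, 12, (([::], 12), ([::], 0)));
  (3, 11, (([:: 0; 2; 1], 11), ([::], 2)));
  (4, 10, (([:: 0; 2; 1], 8), ([::], 2)));
  (5, 9, (([:: 0; 2; 1], 9), ([::], 2)));
  (6, 8, (([::], 8), ([::], 0)));
  (7, 7, (([:: 3; 1; 2; 0], 8), ([:: 3; 1; 2; 0], 0)));
  (1, 14, (([::], 14), ([::], 0)));
  (2, 13, (([:: 1; 0], 12), ([::], 1)));
  (3, 12, (([::], 12), ([::], 0)));
  (4, 11, (([::], 8), ([::], 4)));
  (5, 10, (([:: 0; 2; 1], 10), ([::], 2)));
  (6, 9, (([:: 2; 1; 0], 8), ([::], 3)));
  (7, 8, (([::], 8), ([::], 0)));
  (1, 15, (([::], 15), ([::], 0)));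
  (2, 14, (([::], 14), ([::], 0)));
  (3, 13, (([::], 15), ([::], 0)));
  (4, 12, (([::], 12), ([::], 0)));
  (5, 11, (([::], 15), ([::], 0)));
  (6, 10, (([::], 14), ([::], 0)));
  (7, 9, (([::], 15), ([::], 0)));
  (8, 8, (([::], 8), ([::], 0)))].

(** The entry for [k] and [k'], exchanged when [k > k']. *)
Definition split_code (k k' : nat) : aut_code * aut_code :=
  let t := if k <= k' then (k, k') else (k', k) in
  let c := (nth (t, (([::], 0), ([::], 0))) split_table
              (index t (unzip1 split_table))).2 in
  if k <= k' then c else (c.2, c.1).

(** The two copies of that entry are as required. *)
Definition split_ok (k k' : nat) : bool :=
  let c := split_code k k' in
  [&& aut_ok c.1, aut_ok c.2, below k (k + k') c.1, below k' (k + k') c.2 &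
      apart k k' c.1 c.2].

(** The finite check behind the upper bound: for [k + k' <= 16], the points of
    value less than [k + k'] fall into a copy of those of value less than [k]
    and a copy of those of value less than [k']. *)
Lemma split_okP k k' : 0 < k -> 0 < k' -> k + k' <= 16 -> split_ok k k'.
Proof.
move=> k0 k0' kk'.
have: all (fun k1 => all (fun k2 => split_ok k1 k2) (iota 1 (16 - k1))) (iota 1 15).
  by vm_compute.
have k16 : k < 16 by rewrite (leq_trans _ kk')// -addn1 leq_add2l.
move=> /allP/(_ k); rewrite mem_iota k0 add1n k16 => /(_ isT) /allP/(_ k').
by apply; rewrite mem_iota k0' add1n ltnS leq_subRL// ltnW.
Qed.

(** A copy of rank [rk S] cut into copies of ranks [k] and [rk S - k]. *)
Definition split_region (k : nat) (S : region) : region * region :=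
  let c := split_code k (rk S - k) in
  (subregion k (aut c.1) S, subregion (rk S - k) (aut c.2) S).

Lemma split_regionP k S : proper_region S -> 0 < k < rk S -> rk S <= 16 ->
  let S1 := (split_region k S).1 in let S2 := (split_region k S).2 in
  [/\ proper_region S1, proper_region S2,
      forall x, size x = 6 -> inside S1 x -> inside S x,
      forall x, size x = 6 -> inside S2 x -> inside S x &
      forall x, size x = 6 -> inside S1 x -> ~~ inside S2 x].
Proof.
move=> pS /andP[k0 kS] S16; have kE : k + (rk S - k) = rk S by rewrite subnKC// ltnW.
have := @split_okP k (rk S - k) k0; rewrite subn_gt0 kE => /(_ kS S16).
rewrite /split_ok kE => /and5P[ok1 ok2 b1 b2 ap]; split.
- exact: proper_subregion.
- exact: proper_subregion.
- by move=> x sx; apply: below_inside.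
- by move=> x sx; apply: below_inside.
- by move=> x sx; apply: apart_inside.
Qed.

(** [S] is a region of rank between [k] and 16 within the first [m]
    coordinates. *)
Definition region_in (m k : nat) (S : region) : Prop :=
  [/\ proper_region S, k <= rk S, 0 < rk S <= 16 &
      forall x, size x = 6 -> inside S x -> pval x < 2 ^ m].

Definition disjoint_regions (S S' : region) : Prop :=
  forall x, size x = 6 -> inside S x -> ~~ inside S' x.

Lemma disjoint_regionsC S S' : disjoint_regions S S' -> disjoint_regions S' S.
Proof. by move=> H x sx; apply: contraTN => /(H x sx). Qed.

(** Three disjoint regions for groups of [a], [b] and [c] leaves. *)
Definition packing (m a b c : nat) : Prop := exists S1 S2 S3,
  [/\ region_in m a S1, region_in m b S2 & region_in m c S3] /\
  [/\ disjoint_regions S1 S2, disjoint_regions S1 S3 & disjoint_regions S2 S3].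

(** For [a >= b >= c] at most 15 with [a + b + c = 31], automorphisms that place
    copies of the first [b] and of the first [c] points in the 5-cube, disjointly
    from each other and from the first [a] points. *)
Definition pack_table : seq (nat * nat * nat * (aut_code * aut_code)) := [::
  (11, 10, 10, (([::], 16), ([:: 0; 1; 4; 2; 3], 30)));
  (11, 11, 9, (([::], 16), ([:: 0; 1; 4; 2; 3], 27)));
  (12, 10, 9, (([::], 16), ([:: 0; 1; 4; 2; 3], 30)));
  (12, 11, 8, (([::], 16), ([:: 0; 1; 4; 3; 2], 24)));
  (12, 12, 7, (([::], 16), ([:: 0; 1; 4; 3; 2], 24)));
  (13, 9, 9, (([:: 0; 3; 2; 4; 1], 15), ([:: 0; 3; 2; 4; 1], 30)));
  (13, 10, 8, (([:: 0; 1; 2; 4; 3], 30), ([::], 16)));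
  (13, 11, 7, (([::], 16), ([:: 0; 1; 4; 3; 2], 31)));
  (13, 12, 6, (([::], 16), ([:: 0; 1; 4; 3; 2], 30)));
  (13, 13, 5, (([::], 16), ([:: 0; 4; 1; 3; 2], 29)));
  (14, 9, 8, (([:: 0; 1; 2; 4; 3], 30), ([::], 16)));
  (14, 10, 7, (([:: 0; 1; 2; 4; 3], 30), ([::], 16)));
  (14, 11, 6, (([::], 16), ([:: 0; 1; 4; 3; 2], 30)));
  (14, 12, 5, (([::], 16), ([:: 0; 1; 4; 3; 2], 30)));
  (14, 13, 4, (([::], 16), ([:: 0; 4; 2; 3; 1], 28)));
  (14, 14, 3, (([::], 16), ([:: 0; 4; 2; 3; 1], 28)));
  (15, 8, 8, (([::], 16), ([::], 24)));
  (15, 9, 7, (([::], 16), ([::], 31)));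
  (15, 10, 6, (([::], 16), ([::], 30)));
  (15, 11, 5, (([::], 16), ([::], 31)));
  (15, 12, 4, (([::], 16), ([::], 28)));
  (15, 13, 3, (([::], 16), ([::], 31)));
  (15, 14, 2, (([::], 16), ([::], 30)));
  (15, 15, 1, (([::], 16), ([::], 15)))].

(** The entry for [a], [b] and [c]. *)
Definition pack_code (a b c : nat) : aut_code * aut_code :=
  (nth ((a, b, c), (([::], 0), ([::], 0))) pack_table
     (index (a, b, c) (unzip1 pack_table))).2.

(** The three codes are automorphisms that place disjoint copies of ranks [a],
    [b], [c] in the [m]-cube. *)
Definition codes_ok (m a b c : nat) (ca cb cc : aut_code) : bool :=
  [&& aut_ok ca, aut_ok cb & aut_ok cc] &&
  [&& below a (2 ^ m) ca, below b (2 ^ m) cb & below c (2 ^ m) cc] &&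
  [&& apart a b ca cb, apart a c ca cc & apart b c cb cc].

Lemma packing_codes m a b c a' b' c' ca cb cc :
  a <= a' -> b <= b' -> c <= c' ->
  0 < a' <= 16 -> 0 < b' <= 16 -> 0 < c' <= 16 ->
  codes_ok m a' b' c' ca cb cc -> packing m a b c.
Proof.
move=> aa bb bc a16 b16 c16 /andP[/andP[/and3P[oa ob oc] /and3P[ba bb' bc']]].
move=> /and3P[ab ac bc3]; pose I := idregion (2 ^ m).
have pI : proper_region I by [].
have reg k k' d : aut_ok d -> k <= k' -> 0 < k' <= 16 -> below k' (2 ^ m) d ->
    region_in m k (subregion k' (aut d) I).
  move=> od kk k16 bd; split=> //; first exact: proper_subregion.
  by move=> x sx; apply: (below_inside pI sx).
exists (subregion a' (aut ca) I), (subregion b' (aut cb) I), (subregion c' (aut cc) I).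
split; first by split; apply: reg.
by split=> x sx; apply: apart_inside.
Qed.

Lemma pack_table_ok :
  all (fun a => all (fun b => let c := 31 - a - b in
    if 0 < c <= b then
      codes_ok 5 a b c ([::], 0) (pack_code a b c).1 (pack_code a b c).2 else true)
    (iota 1 a)) (iota 1 15).
Proof. by vm_compute. Qed.

Lemma packing_swap12 m a b c : packing m a b c -> packing m b a c.
Proof.
move=> [S1 [S2 [S3 [[R1 R2 R3] [D12 D13 D23]]]]].
by exists S2, S1, S3; do ?split=> //; apply: disjoint_regionsC.
Qed.

Lemma packing_swap23 m a b c : packing m a b c -> packing m a c b.
Proof.
move=> [S1 [S2 [S3 [[R1 R2 R3] [D12 D13 D23]]]]].
by exists S1, S3, S2; do ?split=> //; apply: disjoint_regionsC.
Qed.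

(** Up to 31 leaves in three groups of at most 15 fit in the 5-cube. *)
Lemma packing31 a b c : a <= 15 -> b <= 15 -> c <= 15 -> a + b + c <= 31 ->
  packing 5 a b c.
Proof.
wlog ba : a b c / b <= a.
  move=> W a15 b15 c15 s; case: (leqP b a) => [|/ltnW] ab; first exact: W.
  by apply: packing_swap12; apply: W => //; rewrite (addnC b).
wlog cb : a b c ba / c <= b.
  move=> W a15 b15 c15 s; case: (leqP c b) => [|/ltnW] bc; first exact: W.
  case: (leqP c a) => [|/ltnW] ac.
    by apply: packing_swap23; apply: W => //; rewrite addnAC.
  apply: packing_swap23; apply: packing_swap12; apply: W => //.
  by rewrite addnAC addnC addnA addnAC.
move=> a15 b15 c15 s.
(* enlarge the sizes to have sum 31, keeping them sorted and at most 15 *)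
have [a' [b' [c' [[ha hb hc c'E] [a1 b1 c1 cb' ba']]]]] : exists a' b' c',
    [/\ a <= a', b <= b', c <= c' & 31 - a' - b' = c'] /\
    [/\ 0 < a' <= 15, 0 < b' <= 15, 0 < c' <= 15, c' <= b' & b' <= a'].
  have [big|small] := leqP 15 (31 - b - c); last first.
    by exists (31 - b - c), b, c; split; split; lia.
  by have [c0|c1] := leqP c 1; [exists 15, 15, 1|exists 15, (16 - c), c]; split; split; lia.
have /allP/(_ a') := pack_table_ok; rewrite mem_iota add1n ltnS a1 => /(_ isT).
move=> /allP/(_ b'); rewrite mem_iota add1n ltnS ba' andbT.
case/andP: (b1) => -> _ => /(_ isT); cbv zeta; rewrite c'E cb' andbT.
case/andP: (c1) => -> _ ok; apply: (packing_codes ha hb hc _ _ _ ok).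
- by lia.
- by lia.
- by lia.
Qed.

(** Three groups of at most 16 leaves fit in the 6-cube. *)
Lemma packing48 a b c : a <= 16 -> b <= 16 -> c <= 16 -> packing 6 a b c.
Proof.
have ok : codes_ok 6 16 16 16 ([::], 0) ([::], 16) ([::], 32) by vm_compute.
by move=> a16 b16 c16; exact: (packing_codes _ _ _ _ _ _ ok).
Qed.

(** * From regions to embeddings *)

Definition subset_region (S S' : region) : Prop :=
  forall x, size x = 6 -> inside S x -> inside S' x.

(** The region of [S] assigned to [v] when [S] is cut successively for the
    members of [cs], each [c] receiving a copy of rank at least [w c]. *)
Fixpoint comb (T : eqType) (w : T -> nat) (S : region) (cs : seq T) (v : T) :=
  if cs is c :: cs' then
    if nilp cs' then S else
    if v == c then (split_region (w c) S).1
    else comb w (split_region (w c) S).2 cs' v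
  else S.

Lemma combP (T : eqType) m (w : T -> nat) S cs :
  uniq cs -> (forall c, c \in cs -> 0 < w c) ->
  region_in m (\sum_(c <- cs) w c) S ->
  (forall v, v \in cs -> region_in m (w v) (comb w S cs v) /\
                         subset_region (comb w S cs v) S) /\
  (forall v v', v \in cs -> v' \in cs -> v != v' ->
     disjoint_regions (comb w S cs v) (comb w S cs v')).
Proof.
elim: cs S => [|c cs IHcs] S /=; first by split.
move=> /andP[cNcs ucs] wpos; rewrite big_cons => -[pS kS rS mS].
have wc : 0 < w c by apply: wpos; rewrite mem_head.
have wcs c' : c' \in cs -> 0 < w c'.
  by move=> c'cs; apply: wpos; rewrite inE c'cs orbT.
case: nilP => [cs0|/eqP csN0].
  rewrite cs0; split => [v|v v']; rewrite !inE => /eqP-> //; last first.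
    by move=> /eqP ->; rewrite eqxx.
  split=> //; split=> //; apply: leq_trans kS.
  by rewrite cs0 big_nil addn0.
have sum0 : 0 < \sum_(c' <- cs) w c'.
  case: (cs) csN0 wcs => // d ds _ H; rewrite big_cons.
  by rewrite ltn_addr// H// mem_head.
have [|p1 p2 i1 i2 d12] := @split_regionP (w c) S pS _ (proj2 (andP rS)).
  by rewrite wc /= (leq_trans _ kS)// -[X in X < _]addn0 ltn_add2l.
case: S mS kS rS pS p1 p2 i1 i2 d12 => k h g.
set S := Region k h g => mS kS rS pS p1 p2 i1 i2 d12.
have k16 : k <= 16 by case/andP: rS.
have R1 : region_in m (w c) (split_region (w c) S).1.
  split=> //; first by rewrite /= wc (leq_trans _ k16)// (leq_trans _ kS)// leq_addr.
  by move=> x sx /(i1 _ sx); apply: mS.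
have R2 : region_in m (\sum_(c' <- cs) w c') (split_region (w c) S).2.
  split=> //=.
  - by rewrite -(leq_add2l (w c)) subnKC// (leq_trans _ kS)// leq_addr.
  - rewrite (leq_trans (leq_subr _ _))// andbT subn_gt0 (leq_trans _ kS)//.
    by rewrite -[X in X < _]addn0 ltn_add2l.
  - by move=> x sx /(i2 _ sx); apply: mS.
have [IH1 IH2] := IHcs _ ucs wcs R2.
have IHd v : v \in cs ->
    disjoint_regions (split_region (w c) S).1 (comb w (split_region (w c) S).2 cs v).
  move=> vcs x sx /(d12 x sx); apply: contraNN.
  by have [_] := IH1 v vcs; apply.
split=> [v|v v']; rewrite !inE.
  case: eqVneq => [-> _|vc /= vcs]; first by split.
  have [? sub] := IH1 v vcs; split=> // x sx /(sub x sx); exact: i2.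
case: eqVneq => [->|vc] /=; case: eqVneq => [->|vc'] //=.
- by move=> _ v'cs _; apply: IHd.
- by move=> vcs _ _; apply/disjoint_regionsC/IHd.
exact: IH2.
Qed.

(** A tree rooted at [r], with disjoint regions [rst c] of the [m]-cube given
    for the edges at the root, none of them covering the [m]-cube. *)
Section Regions.
Variables (T : tree) (r : T) (m : nat) (rst : T -> region).
Hypothesis rst_in : forall c, adj r c -> region_in m (weight r c) (rst c).
Hypothesis rst_disj : forall c c', adj r c -> adj r c' -> c != c' ->
  disjoint_regions (rst c) (rst c').
Hypothesis rst_proper : forall c, adj r c ->
  exists x, [/\ size x = 6, pval x < 2 ^ m & ~~ inside (rst c) x].

Let p := parent r.

(** The neighbours of [v] other than its parent. *)
Definition children v := [seq c <- enum T | adj v c && (c != p v)].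

(** The region of the edge above [v], by recursion on the depth [n] of [v]. *)
Fixpoint regn n v : region :=
  if n is n'.+1 then
    if p v == r then rst v else comb (weight (p v)) (regn n' (p v)) (children (p v)) v
  else rst v.

(** The region of the edge above [v]: given at the neighbours of the root, cut
    from the region of the parent elsewhere. *)
Definition reg v := regn (tdist v r) v.

Lemma reg_root v : v != r -> p v = r -> reg v = rst v.
Proof.
move=> vr pv; have [_] := parentP vr; rewrite /reg => -> /=.
by rewrite pv eqxx.
Qed.

Lemma reg_comb v : v != r -> p v != r ->
  reg v = comb (weight (p v)) (reg (p v)) (children (p v)) v.
Proof.
by move=> vr pv; have [_] := parentP vr; rewrite /reg => -> /=; rewrite (negPf pv).
Qed.

Lemma mem_children v : v != r -> p v != r -> v \in children (p v).
Proof.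
move=> vr pvr; rewrite mem_filter mem_enum andbT.
have [vp dv] := parentP vr; have [_ dpv] := parentP pvr.
rewrite adj_sym vp /=; apply/eqP => E; move: dv; rewrite dpv -[parent r _]E.
by move/eqP; rewrite eqn_leq (ltnNge _.+1) leqnSn andbF.
Qed.

Lemma reg_child u : u != r ->
  region_in m (weight (p u) u) (reg u) ->
  (forall v, v \in children u ->
     region_in m (weight u v) (comb (weight u) (reg u) (children u) v) /\
     subset_region (comb (weight u) (reg u) (children u) v) (reg u)) /\
  (forall v v', v \in children u -> v' \in children u -> v != v' ->
     disjoint_regions (comb (weight u) (reg u) (children u) v)
                      (comb (weight u) (reg u) (children u) v')).
Proof.
move=> ur [pS kS rS mS]; apply: combP.
- by rewrite filter_uniq ?enum_uniq.
- by move=> c; rewrite mem_filter => /andP[/andP[uc _] _]; apply: weight_gt0.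
split=> //; apply: leq_trans kS; apply: sum_weight_branch.
- by rewrite adj_sym; case: (parentP ur).
- by rewrite filter_uniq ?enum_uniq.
- by move=> c; rewrite mem_filter => /andP[].
Qed.

Lemma reg_in v : v != r -> region_in m (weight (p v) v) (reg v).
Proof.
move d : (tdist v r) => n; elim: n v d => [|n IHn] v d vr.
  by rewrite -tdist_eq0 d in vr.
have [vp] := parentP vr; rewrite d => -[] /esym dp.
have [pvr|pvr] := eqVneq (p v) r.
  by rewrite reg_root// pvr; apply: rst_in; rewrite adj_sym -pvr.
rewrite reg_comb//.
by have [/(_ v (mem_children vr pvr))[]] := reg_child pvr (IHn _ dp pvr).
Qed.

Lemma reg_sub v : v != r -> p v != r -> subset_region (reg v) (reg (p v)).
Proof.
move=> vr pvr; rewrite [X in subset_region X _]reg_comb//.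
by have [/(_ v (mem_children vr pvr))[]] := reg_child pvr (reg_in pvr).
Qed.

Lemma reg_disj v v' : v != r -> v' != r -> p v = p v' -> v != v' ->
  disjoint_regions (reg v) (reg v').
Proof.
move=> vr v'r pvv' vv'; have [pvr|pvr] := eqVneq (p v) r.
  rewrite !reg_root// -?pvv'//; apply: rst_disj vv'; rewrite adj_sym.
    by have [] := parentP vr; rewrite -/p -/(p v) pvr.
  by have [] := parentP v'r; rewrite -/p -/(p v') -pvv' pvr.
have pv'r : p v' != r by rewrite -pvv'.
rewrite (reg_comb vr pvr) (reg_comb v'r pv'r) -pvv'.
have [_] := reg_child pvr (reg_in pvr); apply=> //; first exact: mem_children.
by rewrite pvv'; apply: mem_children.
Qed.

Lemma reg_below v : v != r -> exists2 c, adj r c & subset_region (reg v) (rst c).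
Proof.
move d : (tdist v r) => n; elim: n v d => [|n IHn] v d vr.
  by rewrite -tdist_eq0 d in vr.
have [vp] := parentP vr; rewrite d => -[] /esym dp.
have [pvr|pvr] := eqVneq (p v) r.
  by exists v; rewrite ?reg_root// adj_sym -pvr.
have [c rc sub] := IHn _ dp pvr; exists c => // x sx /(reg_sub vr pvr sx).
exact: sub.
Qed.

(** The sign vector of the edge above [v]. *)
Definition sgn v := center (reg v).

Lemma size_sgn v : v != r -> size (sgn v) = 6.
Proof. by case/reg_in => pS _ _ _; apply: size_center. Qed.

(** A point whose coordinates are all taken along a chain of edges lies in the
    region of the top edge: regions increase and are star-shaped. *)
Lemma chain_inside j v y : size y = 6 ->
  (forall n, n <= j -> iter n p v != r) ->
  (forall i, i < 6 -> exists2 n, n <= j & nth false y i = nth false (sgn (iter n p v)) i) ->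
  inside (reg (iter j p v)) y.
Proof.
elim: j y => [|j IHj] y sy nr H.
  have vr : v != r := nr 0 isT.
  have -> : y = sgn v.
    apply: (@eq_from_nth _ false); first by rewrite sy size_sgn.
    by move=> i; rewrite sy => /H[n]; rewrite leqn0 => /eqP ->.
  by have [pS _ /andP[k0 _] _] := reg_in vr; apply: inside_center.
(* [y] lies between [x], whose coordinates come from the chain below the top
   edge, and the sign vector of the top edge *)
pose old i := [exists n : 'I_j.+1, nth false y i == nth false (sgn (iter n p v)) i].
pose x := mkseq (fun i => if old i then nth false y i else nth false (sgn v) i) 6.
have sx : size x = 6 by rewrite size_mkseq.
have xin : inside (reg (iter j p v)) x.
  apply: IHj => // [n nj|i i6]; first by apply: nr; rewrite leqW.
  rewrite nth_mkseq//; case: ifP => [/existsP[n /eqP ->]|_]; last by exists 0.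
  by exists n; rewrite ?leq_ord.
have jr := nr j (leqnSn j); have j1r := nr j.+1 (leqnn _).
have [pS _ _ _] := reg_in j1r.
apply: (inside_hull pS sx sy _ (reg_sub jr j1r sx xin)).
move=> i; case: (ltnP i 6) => i6; last first.
  by left; rewrite !nth_default ?sx ?sy.
rewrite nth_mkseq//; case: ifPn => [_|/existsPn Hold]; first by left.
right; have [n nj E] := H i i6; move: nj; rewrite leq_eqVlt => /orP[/eqP nE|nj].
  by rewrite E nE.
by have := Hold (Ordinal nj); rewrite /= E eqxx.
Qed.

(** Only the first [m] coordinates of the sign vectors are used. *)
Lemma sgn_high v i : v != r -> m <= i -> nth false (sgn v) i = false.
Proof.
move=> vr mi; have [pS _ /andP[k0 _] mS] := reg_in vr.
apply: (@pval_bit m) => //; apply: mS; first exact: size_sgn.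
exact: inside_center.
Qed.

(** A path going up towards the root is consistently oriented in some coordinate:
    otherwise its signs would reach every point of the [m]-cube. *)
Lemma chain_const j v : 0 < j -> (forall n, n < j -> iter n p v != r) ->
  exists (i : 'I_m) b, forall n, n < j ->
    iter n p v != r /\ nth false (sgn (iter n p v)) i = b.
Proof.
case: j => // j _ nr; have [c rc sub] := reg_below (nr j (leqnn _)).
have [x [sx xm xN]] := rst_proper rc.
have /existsP[i /forallP iP] : [exists i : 'I_6, [forall n : 'I_j.+1,
    nth false x i != nth false (sgn (iter n p v)) i]].
  apply: contraNT xN => /existsPn H; apply: sub => //.
  apply: chain_inside => // i i6.
  have := H (Ordinal i6); rewrite negb_forall => /existsP[n]; rewrite negbK => /eqP E.
  by exists n; rewrite ?leq_ord.
have E n : n < j.+1 -> nth false (sgn (iter n p v)) i = ~~ nth false x i.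
  move=> nj; have := iP (Ordinal nj) => /=.
  by case: (nth false x i); case: (nth _ _ _).
have im : i < m.
  rewrite ltnNge; apply/negP => mi; have := E 0 isT.
  by rewrite sgn_high ?(nr 0)// (pval_bit xm).
exists (Ordinal im), (~~ nth false x i) => n nj; split; first exact: nr.
exact: E.
Qed.

(** Two paths that arrive at a vertex through different children have opposite
    constant signs in some coordinate. *)
Lemma chains_opposite j k v w :
  (forall n, n <= j -> iter n p v != r) -> (forall n, n <= k -> iter n p w != r) ->
  iter j.+1 p v = iter k.+1 p w -> iter j p v != iter k p w ->
  exists (i : 'I_m) b,
    (forall n, n < j.+1 -> iter n p v != r /\ nth false (sgn (iter n p v)) i = b) /\
    (forall n, n < k.+1 -> iter n p w != r /\ nth false (sgn (iter n p w)) i = ~~ b).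
Proof.
move=> vr wr jk cc.
have disj := reg_disj (vr j (leqnn _)) (wr k (leqnn _)) jk cc.
(* the value [b] occurs in coordinate [i] along the chain of [j + 1] edges going
   up from [v] *)
pose has1 j v (i : nat) b := [exists n : 'I_j.+1, nth false (sgn (iter n p v)) i == b].
have has1P j' v' i b n : n <= j' -> nth false (sgn (iter n p v')) i = b -> has1 j' v' i b.
  by rewrite -ltnS => nj E; apply/existsP; exists (Ordinal nj); rewrite /= E.
have has1N j' v' i b : ~~ has1 j' v' i b ->
    forall n, n < j'.+1 -> nth false (sgn (iter n p v')) i = ~~ b.
  move=> /existsPn H n nj; have := H (Ordinal nj) => /=.
  by case: (nth _ _ _); case: b {H}.
have any j' v' i b : ~~ has1 j' v' i b -> has1 j' v' i (~~ b).
  by move=> /has1N/(_ 0 isT)/has1P; apply.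
have /existsP[i /existsP[b /andP[/has1N Hv /has1N Hw]]] : [exists i : 'I_6, [exists b,
    ~~ has1 j v i (~~ b) && ~~ has1 k w i b]].
  apply: contraT => /existsPn H.
  (* each coordinate of [y] occurs along both chains *)
  pose y := mkseq (fun i => has1 j v i true && has1 k w i true) 6.
  have sy : size y = 6 by rewrite size_mkseq.
  have hasy i : i < 6 -> has1 j v i (nth false y i) && has1 k w i (nth false y i).
    move=> i6; rewrite nth_mkseq//.
    have /existsPn/= Hi := H (Ordinal i6); have := Hi true; have := Hi false => /=.
    have := @any j v i true; have := @any k w i true.
    case vt: (has1 j v i true); case wt: (has1 k w i true);
      case vf: (has1 j v i false); case wf: (has1 k w i false);
      rewrite /= ?vt ?wt ?vf ?wf //= => A B C D;
      by [have := A isT|have := B isT].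
  have hasE j' v' i b : has1 j' v' i b ->
      exists2 n, n <= j' & b = nth false (sgn (iter n p v')) i.
    by move=> /existsP[n /eqP <-]; exists n; rewrite ?leq_ord.
  have yv : inside (reg (iter j p v)) y.
    by apply: chain_inside => // i /hasy/andP[/hasE].
  have yw : inside (reg (iter k p w)) y.
    by apply: chain_inside => // i /hasy/andP[_ /hasE].
  by have := disj y sy yv; rewrite yw.
rewrite negbK in Hv.
have im : i < m.
  rewrite ltnNge; apply/negP => mi; have := Hv 0 isT; have := Hw 0 isT.
  by rewrite !sgn_high ?(vr 0) ?(wr 0)//; case: (b).
exists (Ordinal im), b; split=> n nj; split; rewrite ?vr ?wr//=; [exact: Hv|exact: Hw].
Qed.

Lemma tdist_iter v n : n <= tdist v r -> tdist (iter n p v) r = tdist v r - n.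
Proof.
elim: n => [|n IHn] nv; first by rewrite subn0.
have {}IHn := IHn (ltnW nv).
have nr : iter n p v != r by rewrite -tdist_eq0 IHn subn_eq0 -ltnNge.
by have [_] := parentP nr; rewrite IHn subnS /= => ->.
Qed.

Lemma iter_neq_root v n : n < tdist v r -> iter n p v != r.
Proof. by move=> nv; rewrite -tdist_eq0 tdist_iter ?(ltnW nv)// subn_eq0 -ltnNge. Qed.

Theorem embeds_of_regions (R : realType) : linfty_embeds R T m.
Proof.
apply: (@embeds_of_signs R T r m (fun i v => nth false (sgn v) i)) => v w vw.
(* the first ancestor [iter j p v] of [v] that is an ancestor of [w] *)
pose A := traject p w (tdist w r).+1.
have rA : r \in A by apply/trajectP; exists (tdist w r); rewrite ?iter_parent_root.
have exj : exists j, iter j p v \in A by exists (tdist v r); rewrite /p iter_parent_root.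
case: (ex_minnP exj) => j /trajectP[k0 k0w jk0] jmin.
have exk : exists k, iter k p w == iter j p v by exists k0; rewrite jk0.
case: (ex_minnP exk) => k /eqP kE kmin.
have kw : k <= tdist w r by apply: leq_trans (kmin k0 _) _; [rewrite jk0|rewrite -ltnS].
have wr n : n < k -> iter n p w != r.
  by move=> nk; apply: iter_neq_root; apply: leq_trans kw.
have vr n : n < j -> iter n p v != r.
  by rewrite ltnNge => nj; apply: contraNneq nj => E; apply: jmin; rewrite E.
case: j {exj} => [|j] in jk0 jmin exk kE kmin vr *.
  have k0' : 0 < k by case: (k) kE => // /= E; rewrite E eqxx in vw.
  have [i [b H]] := chain_const k0' wr.
  by exists i, (~~ b), 0, k; split=> // n nk; rewrite negbK; apply: H.
case: k {k0w} => [|k] in kE kmin kw wr *.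
  have [i [b H]] := chain_const (isT : 0 < j.+1) vr.
  by exists i, b, j.+1, 0; split.
have cc : iter j p v != iter k p w.
  apply/eqP => E; suff: j.+1 <= j by rewrite ltnn.
  by apply: jmin; apply/trajectP; exists k => //; rewrite ltnS ltnW.
have [i [b [Hv Hw]]] := chains_opposite vr wr (esym kE) cc.
by exists i, b, j.+1, k.+1; split.
Qed.

End Regions.

(** * Upper bounds *)

(** Rooting at a leaf leaves at most [2 ^ m - 1] other leaves: the single edge at
    the root gets all the points of the [m]-cube but one. *)
Lemma embeds_small (R : realType) (T : tree) m :
  1 < nleaves T <= 2 ^ m -> 0 < m <= 4 -> linfty_embeds R T m.
Proof.
move=> /andP[t1 tm] /andP[m0 m4].
have [r rL] : exists r, r \in leaves T.
  by apply/card_gt0P; apply: ltnW t1.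
have uniq_nbr c c' : adj r c -> adj r c' -> c = c'.
  move: (rL); rewrite inE => /cards1P[d dE] rc rc'.
  move/setP: dE => dE; have := dE c; have := dE c'.
  by rewrite !inE rc rc' => /esym/eqP-> /esym/eqP->.
have m1 : 1 < 2 ^ m by rewrite -(expn0 2) ltn_exp2l.
have m16 : 2 ^ m <= 16 by rewrite -[16]/(2 ^ 4) leq_exp2l.
apply: (@embeds_of_regions T r m (fun _ => idregion (2 ^ m).-1)).
- move=> c rc; split=> //=.
  + have := @sum_weight_all T [:: c] r isT; rewrite big_seq1 rL => H.
    apply: leq_trans (H _) _; first by move=> d; rewrite inE => /eqP ->.
    by rewrite subn1 -!subn1 leq_sub2r.
  + by rewrite -ltnS prednK ?(ltnW m1)// m1 (leq_trans (leq_pred _)).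
  + by move=> x _; rewrite /inside /= => /leq_trans; apply; rewrite leq_pred.
- by move=> c c' rc rc'; rewrite (uniq_nbr c c') ?eqxx.
move=> c _; exists (nseq m true ++ nseq (6 - m) false).
have -> : pval (nseq m true ++ nseq (6 - m) false) = (2 ^ m).-1.
  by move: m m0 m4 {tm m1 m16} => [|[|[|[|[|]]]]].
split; last by rewrite /inside /=; move: m m0 m4 {tm m1 m16} => [|[|[|[|[|]]]]].
  by rewrite size_cat !size_nseq subnKC// (leq_trans m4).
by rewrite prednK// ltnW.
Qed.

(** A sequence of weights at most [H] and of sum at most [2 H + 1] is cut into
    three consecutive parts of sum at most [H]. *)
Lemma three_groups (T : eqType) (w : T -> nat) (H : nat) (cs : seq T) :
  (forall c, c \in cs -> w c <= H) -> \sum_(c <- cs) w c <= H.*2.+1 ->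
  exists s1 s2 s3, cs = s1 ++ s2 ++ s3 /\
    [/\ \sum_(c <- s1) w c <= H, \sum_(c <- s2) w c <= H & \sum_(c <- s3) w c <= H].
Proof.
suff G s0 : \sum_(c <- s0) w c <= H -> forall s, (forall c, c \in s -> w c <= H) ->
    \sum_(c <- s0 ++ s) w c <= H.*2.+1 -> exists s1 s2 s3, s0 ++ s = s1 ++ s2 ++ s3 /\
    [/\ \sum_(c <- s1) w c <= H, \sum_(c <- s2) w c <= H & \sum_(c <- s3) w c <= H].
  by apply: (G [::]); rewrite big_nil.
move=> s0H s; elim: s s0 s0H => [|c s IHs] s0 s0H wH sH.
  by exists s0, [::], [::]; rewrite cats0 !big_nil.
have [le|gt] := leqP (\sum_(c <- rcons s0 c) w c) H.
  rewrite -cat_rcons in sH *; apply: IHs => // d ds.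
  by apply: wH; rewrite inE ds orbT.
exists s0, [:: c], s; split=> //; split=> //.
  by rewrite big_seq1; apply: wH; rewrite mem_head.
move: sH; rewrite -cat_rcons big_cat /= => sH.
rewrite -(leq_add2l H.+1) [H.+1 + H]addSn addnn; apply: leq_trans sH.
by rewrite leq_add2r.
Qed.

(** The tree is rooted at a centroid and its branches are put in three groups of
    at most [H] leaves. *)
Lemma embeds_packing (R : realType) (T : tree) m H :
  nleaves T <= H.*2.+1 ->
  (forall a b c, a <= H -> b <= H -> c <= H -> a + b + c <= nleaves T ->
     packing m a b c) ->
  linfty_embeds R T m.
Proof.
move=> tH pack; have [r rH] := centroid tH.
pose cs := [seq c <- enum T | adj r c].
have csE c : (c \in cs) = adj r c by rewrite mem_filter mem_enum andbT.
have ucs : uniq cs by rewrite filter_uniq ?enum_uniq.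
have sumT : \sum_(c <- cs) weight r c <= nleaves T.
  apply: leq_trans (sum_weight_all ucs _) (leq_subr _ _).
  by move=> c; rewrite csE.
have [s1 [s2 [s3 [csS [h1 h2 h3]]]]] : exists s1 s2 s3, cs = s1 ++ s2 ++ s3 /\
    [/\ \sum_(c <- s1) weight r c <= H, \sum_(c <- s2) weight r c <= H
      & \sum_(c <- s3) weight r c <= H].
  apply: three_groups; last exact: leq_trans tH.
  by move=> c; rewrite csE => /rH.
have [S1 [S2 [S3 [[R1 R2 R3] [d12 d13 d23]]]]] : packing m (\sum_(c <- s1) weight r c)
    (\sum_(c <- s2) weight r c) (\sum_(c <- s3) weight r c).
  by apply: pack => //; apply: leq_trans sumT; rewrite csS !big_cat /= addnA.
move: ucs; rewrite csS !cat_uniq => /and3P[u1 n1 /and3P[u2 n2 u3]].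
have wpos c : c \in cs -> 0 < weight r c by rewrite csE; apply: weight_gt0.
have [a1 b1] := combP u1 (fun c cs1 => wpos c ltac:(by rewrite csS mem_cat cs1)) R1.
have [a2 b2] := combP u2 (fun c cs2 => wpos c ltac:(by rewrite csS !mem_cat cs2 orbT)) R2.
have [a3 b3] := combP u3 (fun c cs3 => wpos c ltac:(by rewrite csS !mem_cat cs3 !orbT)) R3.
pose rst c := if c \in s1 then comb (weight r) S1 s1 c else
  if c \in s2 then comb (weight r) S2 s2 c else comb (weight r) S3 s3 c.
have dsub S S' U U' : disjoint_regions S S' -> subset_region U S -> subset_region U' S' ->
    disjoint_regions U U'.
  by move=> d s s' x sx /(s x sx)/(d x sx); apply: contraNN; apply: s'.
have other S S' m' k k' U : region_in m' k S -> region_in m' k' S' -> disjoint_regions S S' ->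
    subset_region U S -> exists x, [/\ size x = 6, pval x < 2 ^ m' & ~~ inside U x].
  move=> _ [pS' _ /andP[k0 _] mS'] d s; exists (center S'); split.
  - exact: size_center.
  - by apply: mS'; [apply: size_center|apply: inside_center].
  apply: contraTN (inside_center pS' k0) => /(s _ (size_center pS')).
  by apply: d; apply: size_center.
have rc3 c : adj r c -> [|| c \in s1, c \in s2 | c \in s3].
  by rewrite -csE csS !mem_cat.
apply: (@embeds_of_regions T r m rst).
- move=> c /rc3; rewrite /rst; case: ifP => [/a1[]//|_]; case: ifP => [/a2[]//|_ /=].
  by case/a3.
- move=> c c' /rc3 cr /rc3 c'r cc'; rewrite /rst.
  move: cr c'r; case c1: (c \in s1); case c1': (c' \in s1) => /=.
  + by move=> _ _; apply: b1.
  + move=> _; have [_ q1] := a1 _ c1; case: ifP => [/a2[_ q2] _|_ /= /a3[_ q3]].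
      exact: (dsub _ _ _ _ d12 q1 q2).
    exact: (dsub _ _ _ _ d13 q1 q3).
  + have [_ q1] := a1 _ c1'; case: ifP => [/a2[_ q2] _ _|_ /= /a3[_ q3] _].
      exact/disjoint_regionsC/(dsub _ _ _ _ d12 q1 q2).
    exact/disjoint_regionsC/(dsub _ _ _ _ d13 q1 q3).
  case c2: (c \in s2); case c2': (c' \in s2) => /=.
  + by move=> _ _; apply: b2.
  + by move=> _ /a3[_ q3]; have [_ q2] := a2 _ c2; exact: (dsub _ _ _ _ d23 q2 q3).
  + move=> /a3[_ q3] _; have [_ q2] := a2 _ c2'.
    exact/disjoint_regionsC/(dsub _ _ _ _ d23 q2 q3).
  + by move=> c3 c3'; apply: b3.
move=> c /rc3; rewrite /rst.
case: ifP => [/a1[_ q] _|_]; first exact: (other _ _ _ _ _ _ R1 R2 d12 q).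
case: ifP => [/a2[_ q] _|_ /= /a3[_ q]]; first exact: (other _ _ _ _ _ _ R2 R3 d23 q).
exact: (other _ _ _ _ _ _ R3 R2 (disjoint_regionsC d23) q).
Qed.

Lemma embeds_up_log (R : realType) (T : tree) :
  1 < nleaves T <= 31 -> linfty_embeds R T (up_log 2 (nleaves T)).
Proof.
move=> /andP[t1 t31]; have [t16|t16] := leqP (nleaves T) 16.
  apply: embeds_small; first by rewrite t1 up_logP.
  by rewrite up_log_gt0 t1 /= (leq_trans (leq_up_log 2 t16)).
have -> : up_log 2 (nleaves T) = 5.
  by apply: (@up_log_eq 2 4) => //; rewrite t16 (leq_trans t31).
apply: (@embeds_packing R T 5 15) => // a b c a15 b15 c15 s.
by apply: packing31 => //; apply: leq_trans t31.
Qed.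

Lemma embeds32 (R : realType) (T : tree) : nleaves T = 32 -> linfty_embeds R T 6.
Proof.
move=> t; apply: (@embeds_packing R T 6 16); first by rewrite t.
by move=> a b c a16 b16 c16 _; apply: packing48.
Qed.

(** * Trees given by parent functions *)

Section ParentTree.
Variables (n : nat) (p : nat -> nat).
Hypothesis p_lt : forall i, 0 < i -> p i < i.
Implicit Types i j : 'I_n.+1.

(** Every positive vertex [i] is joined to [p i]. *)
Definition parent_adj : rel 'I_n.+1 :=
  fun i j => (0 < i) && (p i == j) || (0 < j) && (p j == i).

Lemma parent_adj_sym : symmetric parent_adj.
Proof. by move=> i j; rewrite /parent_adj orbC. Qed.

Lemma parent_adj_irr : irreflexive parent_adj.
Proof.
by move=> i; rewrite /parent_adj orbb; case: posnP => //= i0; rewrite ltn_eqF// p_lt.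
Qed.

Lemma parent_adj_card : 0 < #|'I_n.+1|.
Proof. by rewrite card_ord. Qed.

Lemma parent_adj_connected i j : connect parent_adj i j.
Proof.
suff H i' : connect parent_adj i' ord0.
  apply: (connect_trans (H i)); rewrite (sym_connect_sym parent_adj_sym); exact: H.
have [k] := ubnP (val i'); elim: k i' => // k IHk i' ik.
case: (posnP i') => [i0|i0]; first by rewrite (_ : i' = ord0)//; apply: val_inj.
have pn : p i' < n.+1 by rewrite (ltn_trans (p_lt i0)).
apply: (@connect_trans _ _ (Ordinal pn)); first by apply: connect1; rewrite /parent_adj i0 eqxx.
by apply: IHk => /=; rewrite (leq_trans (p_lt i0)).
Qed.

(** The largest vertex of a cycle has a single smaller neighbour. *)
Lemma parent_adj_acyclic (c : seq 'I_n.+1) : ucycle parent_adj c -> size c <= 2.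
Proof.
case: c => // x0 c0; set c := x0 :: c0 => /andP[cc uc].
case: (@arg_maxnP _ x0 (mem c) (fun i => val i) (mem_head _ _)) => x xc0 xmax.
have xc : x \in c := xc0.
have [k c' cE] := rot_to xc; rewrite leqNgt; apply/negP => sc.
have up y : y \in c -> parent_adj x y -> p x = y.
  move=> yc /orP[/andP[_ /eqP//]|/andP[y0 /eqP py]].
  by have le : y <= x := xmax y yc; move: (p_lt y0); rewrite py ltnNge le.
have := cc; rewrite -(rot_cycle k) cE /=.
have := uc; rewrite -(rot_uniq k) cE.
have : 2 < size (x :: c') by rewrite -cE size_rot.
have memc y : y \in x :: c' -> y \in c by rewrite -cE mem_rot.
case: c' {cE} memc => [|y c'] memc //=.
case/lastP: c' memc => [|c' z] memc //.
move=> _ /and3P[_ yN _]; rewrite rcons_path last_rcons => /and3P[xy _ zx].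
have yz : p x = y by apply: up => //; apply: memc; rewrite !inE eqxx orbT.
have : p x = z.
  apply: up; last by rewrite parent_adj_sym.
  by apply: memc; rewrite !inE mem_rcons mem_head !orbT.
rewrite yz => /val_inj yz'; move: yN.
by rewrite yz' mem_rcons mem_head.
Qed.

(** The tree on [0], ..., [n] in which every positive [i] is joined to
    [p i < i]. *)
Definition parent_tree : tree :=
  Tree parent_adj_sym parent_adj_irr parent_adj_card parent_adj_connected
    parent_adj_acyclic.

End ParentTree.

Lemma card_ord_count n (P : pred nat) : #|[set i : 'I_n | P i]| = count P (iota 0 n).
Proof.
rewrite cardsE cardE size_filter -val_enum_ord count_map -enumT.
by apply: eq_count.
Qed.

(** The star with centre 0 and [n] further vertices. *)
Definition star_tree n : tree := @parent_tree n (fun _ => 0) (fun _ => id).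

Lemma nleaves_star n : 1 < n -> nleaves (star_tree n) = n.
Proof.
move=> n1; rewrite /nleaves (_ : [set x | _] = [set~ ord0]).
  by rewrite cardsC1 card_ord.
apply/setP => x; rewrite !inE.
have [->|x0] := eqVneq x ord0; apply/eqP.
  rewrite (_ : [set y | _] = [set~ ord0]).
    by rewrite cardsC1 card_ord => /= E; move: n1; rewrite E.
  by apply/setP => y; rewrite !inE /= /parent_adj /= andbT lt0n.
apply/eqP/cards1P; exists ord0; apply/setP => y; rewrite !inE /= /parent_adj /=.
have x0' : 0 < x by rewrite lt0n.
by rewrite x0' [0 == x :> nat]eq_sym (gtn_eqF x0') andbF orbF /= eq_sym.
Qed.

(** * Labels of the leaves *)

(** The only edge leaving [S] goes from [u] to [v]. *)
Definition is_cut (T : tree) (S : pred T) (u v : T) : Prop :=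
  forall x y, adj x y -> S x -> ~~ S y -> x = u /\ y = v.

(** Labels of the leaves in the [m]-cube such that each side of an edge is
    separated from the other side along the orientation of that edge. *)
Definition separating (T : tree) (m : nat) (lab : T -> 'I_m -> bool) : Prop :=
  forall (S : pred T) u v, is_cut S u v ->
    exists s : 'I_m -> bool, forall a b, a \in leaves T -> b \in leaves T ->
      S a -> ~~ S b -> exists i, lab a i = s i /\ lab b i = ~~ s i.

Local Open Scope ring_scope.

(** The label of a leaf records, for each coordinate of an embedding, whether
    it increases along the edge at the leaf. *)
Lemma embeds_separating (R : realType) (T : tree) m :
  linfty_embeds R T m -> exists lab, separating (T := T) (m := m) lab.
Proof.
move=> [f fE]; pose phi i (v : T) : R := f v ord0 i.
pose nb (a : T) : T := odflt a [pick y | adj a y].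
pose lab (a : T) i := phi i a < phi i (nb a).
exists lab => S u v cut; exists (fun i => phi i u < phi i v) => a b aL bL Sa Sb.
have lip i x y : `|phi i x - phi i y| <= (tdist x y)%:R.
  rewrite -fE [leRHS]mx_normrE; apply: le_trans (le_bigmax _ _ (ord0, i)).
  by rewrite /= !mxE.
have ab : a != b by apply: contraNneq Sb => <-.
have [i Ei] : exists i, (tdist a b)%:R <= `|phi i a - phi i b|.
  have := fE a b; rewrite [LHS]mx_normrE => E.
  have : (tdist a b)%:R <= (tdist a b)%:R :> R by [].
  rewrite -[leRHS]E => /bigmax_geP[|[[z i] _]] /=.
    by rewrite -[0]/(0%:R) ler_nat leqn0 tdist_eq0 (negPf ab).
  by rewrite !mxE (ord1 z) => H; exists i.
(* the coordinate [i] is monotone along the path from [a'] to [b'] *)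
have mono a' b' x y : (tdist a' b')%:R <= `|phi i a' - phi i b'| ->
    tdist a' b' = (tdist a' x + (tdist y b').+1)%N ->
    (phi i x < phi i y) = (phi i a' < phi i b').
  move=> + E; rewrite {}E natrD -natr1 => H.
  have := lip i a' x; have := lip i y b'.
  rewrite !ler_norml => /andP[p1 p2] /andP[p3 p4].
  have q1 : 0 <= (tdist a' x)%:R :> R by rewrite ler0n.
  have q2 : 0 <= (tdist y b')%:R :> R by rewrite ler0n.
  move: H; rewrite ler_normr => /orP[] H; last by apply/idP/idP => _; lra.
  by rewrite !ltNge; congr (~~ _); apply/idP/idP => _; lra.
have nbE a' b' : a' \in leaves T -> a' != b' ->
    tdist a' b' = (tdist a' a' + (tdist (nb a') b').+1)%N.
  move=> aL' ab'; apply: (@tdist_cut _ (pred1 a')); rewrite /= ?eqxx// 1?eq_sym//.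
  move=> x y xy /eqP xa _; split=> //; rewrite xa in xy.
  move: aL'; rewrite inE => /cards1P[z /setP zE].
  rewrite /nb; case: pickP => [t at'|/(_ y)]; last by rewrite xy.
  by have := zE y; have := zE t; rewrite !inE at' xy => /esym/eqP-> /esym/eqP->.
exists i; split.
  by rewrite /lab (mono a b a (nb a) Ei (nbE a b aL ab))
             (mono a b u v Ei (tdist_cut cut Sa Sb)).
have ba : b != a by rewrite eq_sym.
have Ei' : (tdist b a)%:R <= `|phi i b - phi i a| by rewrite tdist_sym distrC.
rewrite /lab (mono b a b (nb b) Ei' (nbE b a bL ba)).
rewrite (mono a b u v Ei (tdist_cut cut Sa Sb)).
have : phi i a != phi i b.
  apply: contraTneq Ei => ->; rewrite subrr normr0 -[0]/(0%:R) ler_nat leqn0.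
  by rewrite tdist_eq0.
by case: ltgtP.
Qed.

Local Close Scope ring_scope.

(** A leaf is cut off from all others, so labels are distinct. *)
Lemma separating_inj (T : tree) m (lab : T -> 'I_m -> bool) : separating lab ->
  {in leaves T &, injective (fun a => [ffun i => lab a i])}.
Proof.
move=> sep a b aL bL ab; apply/eqP/negPn/negP => nab.
have [z zE] : exists z, [set y | adj a y] = [set z].
  by move: aL; rewrite inE => /cards1P.
have cut : is_cut (pred1 a) a z.
  move=> x y xy /eqP xa _; split=> //; move/setP/(_ y): zE.
  by rewrite !inE -xa xy => /esym/eqP.
have [s /(_ a b aL bL)] := sep _ _ _ cut.
rewrite /= eqxx eq_sym nab => /(_ isT isT)[i [la lb]].
by move/ffunP/(_ i): ab; rewrite !ffunE la lb; case: (s i).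
Qed.

Lemma nleaves_le_exp (R : realType) (T : tree) m :
  linfty_embeds R T m -> nleaves T <= 2 ^ m.
Proof.
move=> /embeds_separating[lab /separating_inj inj].
rewrite /nleaves -/(leaves T) -(card_in_imset inj).
by apply: leq_trans (max_card _) _; rewrite card_ffun card_bool card_ord.
Qed.

(** * Search for unate label sets *)

(** Subsets of the 5-cube are coded by 32-bit masks, a point being the number
    with the given coordinates as binary digits. *)
Definition points5 : seq N := [seq N.of_nat k | k <- iota 0 32].

(** The mask of the set of the points satisfying [c]. *)
Definition set_mask (c : N -> bool) : N :=
  foldr (fun y M => if c y then N.setbit M y else M) 0%num points5.

(** The points with coordinate [i] equal to 1. *)
Definition coord_mask (i : nat) : N := nth 0%num
  [:: 2863311530; 3435973836; 4042322160; 4278255360; 4294901760]%num i.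

(** Closure of a set under decreasing, respectively increasing, coordinate [i]. *)
Definition down_closed (U : N) (i : nat) : bool :=
  N.eqb (N.ldiff (N.shiftr (N.land U (coord_mask i)) (2 ^ N.of_nat i)) U) 0.

Definition up_closed (U : N) (i : nat) : bool :=
  N.eqb (N.ldiff (N.land (N.shiftl U (2 ^ N.of_nat i)) (coord_mask i)) U) 0.

(** In each coordinate, the set is closed under decreasing or under increasing
    that coordinate. *)
Definition unate (U : N) : bool :=
  all (fun i => if down_closed U i then true else up_closed U i) (iota 0 5).

(** Insertion without repetition. *)
Definition insert_mask (U : N) (l : seq N) : seq N :=
  if has (N.eqb U) l then l else U :: l.

(** The unate sets that arise as label sets of complete binary trees of
    depth [d]. *)
Fixpoint blob_masks (d : nat) : seq N :=
  if d is d'.+1 then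
    let l := blob_masks d' in
    foldr (fun A r => foldr (fun B r =>
      if N.ltb A B then
        if N.eqb (N.land A B) 0 then
          if unate (N.lor A B) then insert_mask (N.lor A B) r else r
        else r
      else r) r l) [::] l
  else [seq N.shiftl 1 y | y <- points5].

(** Can [U] be extended by disjoint sets listed in [tab] at the indices [ds], in
    this order, so that all the successive unions are unate? *)
Fixpoint search (tab : seq (seq N)) (U : N) (ds : seq nat) : bool :=
  if ds is d :: ds' then
    has (fun V => if N.eqb (N.land U V) 0 then
                    if unate (N.lor U V) then search tab (N.lor U V) ds' else false
                  else false) (nth [::] tab d)
  else true.

Definition blob_table : seq (seq N) := [seq blob_masks d | d <- iota 0 4].

Lemma nth_blob_table d : d < 4 -> nth [::] blob_table d = blob_masks d.
Proof. by move=> d4; rewrite (nth_map 0) ?size_iota// nth_iota. Qed.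

(** The finite check behind the lower bound; the mask 1 codes the set whose only
    element is the point 0. *)
Lemma search_fails :
  search blob_table 1 [:: 2; 3; 2; 3; 0; 0; 0; 0; 0; 0; 0] = false.
Proof. by vm_compute. Qed.

(** The coordinate [i] of the point [y]. *)
Definition bit (y : N) (i : nat) : bool := N.testbit y (N.of_nat i).

Lemma testbit_set_mask c y : N.testbit (set_mask c) y = (y \in points5) && c y.
Proof.
rewrite /set_mask; elim: points5 => [|z l IHl] /=; first by rewrite ?N.bits_0.
rewrite inE; case: (eqVneq y z) IHl => [->|yz] IHl.
  by case cz: (c z); rewrite ?N.setbit_eq//= IHl cz !andbF.
case: (c z) => //; rewrite N.setbit_neq ?IHl// => zy.
by rewrite zy eqxx in yz.
Qed.

Lemma coord_maskE i : i < 5 -> coord_mask i = set_mask (bit^~ i).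
Proof.
suff /allP H : all (fun i => coord_mask i == set_mask (bit^~ i)) (iota 0 5).
  by move=> i5; apply/eqP/H; rewrite mem_iota.
by vm_compute.
Qed.

(** Turning a digit 1 into 0. *)
Lemma clear_bit z i : z \in points5 -> i < 5 -> bit z i ->
  let y := N.sub z (2 ^ N.of_nat i) in
  [/\ y \in points5, bit y i = false &
      forall j, j < 5 -> j != i -> bit y j = bit z j].
Proof.
have: all (fun z => all (fun i => bit z i ==>
    let y := N.sub z (2 ^ N.of_nat i) in
    [&& y \in points5, ~~ bit y i &
        all (fun j => (j == i) || (bit y j == bit z j)) (iota 0 5)])
    (iota 0 5)) points5 by vm_compute.
move=> /allP/(_ z) H zp i5 zi.
move: H => /(_ zp)/allP/(_ i); rewrite mem_iota i5 => /(_ isT)/implyP/(_ zi).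
move=> /and3P[yp /negPf yi /allP yj]; split=> // j j5 ji.
by have := yj j; rewrite mem_iota j5 (negPf ji) => /(_ isT)/eqP.
Qed.

Lemma bit_inj y z : y \in points5 -> z \in points5 ->
  (forall i, i < 5 -> bit y i = bit z i) -> y = z.
Proof.
have: all (fun y => all (fun z =>
    all (fun i => bit y i == bit z i) (iota 0 5) ==> (y == z)) points5) points5.
  by vm_compute.
move=> /allP/(_ y) H yp zp yz; move: H => /(_ yp)/allP/(_ z zp)/implyP H.
by apply/eqP/H/allP => i; rewrite mem_iota => /yz ->.
Qed.

(** Every vector of coordinates is that of a point. *)
Lemma bit_onto (g : 'I_5 -> bool) :
  exists2 y, y \in points5 & forall i : 'I_5, bit y i = g i.
Proof.
pose num (x : seq bool) :=
  foldr (fun (b : bool) M => if b then N.succ_double M else N.double M) 0%num x.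
have H : forall a b c d e, let x := [:: a; b; c; d; e] in
    (num x \in points5) && all (fun i => bit (num x) i == nth false x i) (iota 0 5).
  by move=> [] [] [] [] []; vm_compute.
pose x := mkseq (fun i => g (inord i)) 5.
have /andP[xp /allP xb] := H (g (inord 0)) (g (inord 1)) (g (inord 2)) (g (inord 3)) (g (inord 4)).
exists (num x) => // i.
have := xb i; rewrite mem_iota ltn_ord => /(_ isT)/eqP.
by rewrite -[X in nth _ X]/x nth_mkseq// inord_val.
Qed.

Lemma mem_insert_mask U V l : V \in insert_mask U l = (V == U) || (V \in l).
Proof.
rewrite /insert_mask; case: ifP => // h.
case: eqVneq => // ->; rewrite /= -has_pred1 -[RHS]h.
by apply: eq_has => x /=; rewrite eq_sym.
Qed.

Lemma mem_blob_masks d A B : A \in blob_masks d -> B \in blob_masks d ->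
  N.land A B = 0%num -> A <> B -> unate (N.lor A B) -> N.lor A B \in blob_masks d.+1.
Proof.
wlog AB : A B / N.ltb A B.
  move=> W Al Bl AB0 AB uAB; case: (N.lt_trichotomy A B) => [|[|]] lt //.
    by apply: W => //; apply/N.ltb_lt.
  by rewrite N.lor_comm; apply: W; rewrite 1?N.land_comm 1?N.lor_comm//;
    [apply/N.ltb_lt|move/esym].
move=> Al Bl AB0 _ uAB /=; set l := blob_masks d in Al Bl *.
pose F A := foldr (fun B r => if N.ltb A B then if N.eqb (N.land A B) 0 then
  if unate (N.lor A B) then insert_mask (N.lor A B) r else r else r else r).
have Fsub A' r l' V : V \in r -> V \in F A' r l'.
  by move=> Vr; elim: l' => //= B' l' IH; do 3?case: ifP => // _; rewrite mem_insert_mask IH orbT.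
have FB r l' : B \in l' -> N.lor A B \in F A r l'.
  elim: l' => //= B' l' IH; rewrite inE => /orP[/eqP<-|/IH {}IH].
    by rewrite AB AB0 uAB mem_insert_mask eqxx.
  by do 3?case: ifP => // _; rewrite mem_insert_mask IH orbT.
suff: forall l', A \in l' -> N.lor A B \in foldr (fun A r => F A r l) [::] l' by apply.
elim=> //= A' l' IH; rewrite inE => /orP[/eqP<-|/IH {}IH]; first exact: FB.
exact: Fsub.
Qed.

(** * Unateness of the label sets *)

Section Masks.
Variables (T : tree) (lab : T -> 'I_5 -> bool).
Hypothesis sep : separating lab.
(* as many leaves as points: every point of the 5-cube is a label *)
Hypothesis t32 : nleaves T = 32.
Implicit Types (P : pred T) (y z : N).

(** The point [y] is the label of a leaf in [P]. *)
Definition has_label P y : bool :=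
  [exists b, [&& b \in leaves T, P b & [forall i, lab b i == bit y i]]].

(** The set of the labels of the leaves in [P]. *)
Definition label_mask P : N := set_mask (has_label P).

Lemma has_labelP P y :
  reflect (exists b, [/\ b \in leaves T, P b & forall i, lab b i = bit y i])
          (has_label P y).
Proof.
apply: (iffP existsP) => [[b /and3P[bL Pb /forallP lb]]|[b [bL Pb lb]]]; exists b.
  by split=> // i; apply/eqP.
by rewrite bL Pb; apply/forallP => i; apply/eqP.
Qed.

Lemma leaf_of_label y : exists2 b, b \in leaves T & forall i, lab b i = bit y i.
Proof.
pose F (a : T) := [ffun i => lab a i].
have FT : F @: leaves T = [set: {ffun 'I_5 -> bool}].
  apply/eqP; rewrite eqEcard subsetT (card_in_imset (separating_inj sep)) cardsT.
  by rewrite card_ffun card_bool card_ord /leaves -/(nleaves T) t32.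
have : [ffun i : 'I_5 => bit y i] \in F @: leaves T by rewrite FT inE.
case/imsetP => b bL /ffunP E; exists b => // i.
by have := E i; rewrite !ffunE.
Qed.

Lemma lab_inj a b : a \in leaves T -> b \in leaves T ->
  (forall i, lab a i = lab b i) -> a = b.
Proof.
move=> aL bL ab; apply: (separating_inj sep aL bL).
by apply/ffunP => i; rewrite !ffunE.
Qed.

Lemma label_maskU P Q R : {in leaves T, forall b, R b = P b || Q b} ->
  label_mask R = N.lor (label_mask P) (label_mask Q).
Proof.
move=> RE; apply: N.bits_inj => y; rewrite N.lor_spec !testbit_set_mask -andb_orr.
congr andb; apply/has_labelP/orP.
  move=> [b [bL + lb]]; rewrite RE// => /orP[] Pb; [left|right];
    by apply/has_labelP; exists b.
by case=> /has_labelP[b [bL Pb lb]]; exists b; rewrite RE// Pb ?orbT.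
Qed.

Lemma label_maskI P Q : {in leaves T, forall b, P b -> ~~ Q b} ->
  N.land (label_mask P) (label_mask Q) = 0%num.
Proof.
move=> PQ; apply: N.bits_inj_0 => y; rewrite N.land_spec !testbit_set_mask.
apply/negP => /andP[/andP[yp /has_labelP[b [bL Pb lb]]] /andP[_]].
move=> /has_labelP[c [cL Qc lc]].
have bc : b = c by apply: lab_inj => // i; rewrite lb lc.
by have := PQ b bL Pb; rewrite bc Qc.
Qed.

Lemma label_mask_neq P Q a : a \in leaves T -> P a ->
  {in leaves T, forall b, P b -> ~~ Q b} -> label_mask P <> label_mask Q.
Proof.
move=> aL Pa PQ; have [y yp ya'] := bit_onto (lab a).
have ya i : lab a i = bit y i by rewrite ya'.
move/(congr1 (fun M => N.testbit M y)); rewrite !testbit_set_mask yp /=.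
rewrite (_ : has_label P y); last by apply/has_labelP; exists a.
move/esym/has_labelP => [b [bL Qb lb]].
have ab : a = b by apply: lab_inj => // i; rewrite lb ya.
by have := PQ a aL Pa; rewrite ab Qb.
Qed.

(** The label set of a single leaf. *)
Lemma label_mask1 P a : a \in leaves T -> {in leaves T, P =1 pred1 a} ->
  label_mask P \in blob_masks 0 /\
  ((forall i, lab a i = false) -> label_mask P = 1%num).
Proof.
move=> aL Pa; have [y yp ya'] := bit_onto (lab a).
have ya i : lab a i = bit y i by rewrite ya'.
have E : label_mask P = N.shiftl 1 y.
  apply: N.bits_inj => z; rewrite testbit_set_mask N.shiftl_1_l N.pow2_bits_eqb.
  rewrite -[N.eqb y z]/(y == z); apply/andP/eqP => [[zp /has_labelP[b [bL Pb lb]]]|<-]; last first.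
    by split=> //; apply/has_labelP; exists a; split=> //; rewrite Pa//= eqxx.
  move: Pb; rewrite Pa//= => /eqP E; rewrite E in lb.
  apply: bit_inj => // i i5; have := ya (Ordinal i5).
  by have := lb (Ordinal i5) => /= -> /= ->.
split; first by rewrite E; apply: map_f.
move=> a0; rewrite E (_ : y = 0%num)//; apply: bit_inj => // i i5.
by have /= <- := ya (Ordinal i5); rewrite a0 /bit ?N.bits_0.
Qed.

(** The label set of one side of an edge is monotone in each coordinate, in the
    direction of the edge: changing one coordinate of the label of a leaf [a]
    to that of the edge cannot lead to the other side. *)
Lemma unate_label_mask P u v : is_cut P u v -> unate (label_mask P).
Proof.
move=> cut; have [s sP] := sep cut; apply/allP => i; rewrite mem_iota /= => i5.
have lbl z y a b : (forall j, j < 5 -> j != i -> bit y j = bit z j) ->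
    a \in leaves T -> b \in leaves T -> P a -> ~~ P b ->
    (forall j, lab a j = bit z j) -> (forall j, lab b j = bit y j) ->
    s (Ordinal i5) = bit z i.
  move=> zy aL bL Pa Pb la lb; have [j [aj bj]] := sP a b aL bL Pa Pb.
  have ji : j = i :> nat.
    apply/eqP/negPn/negP => ji; have := zy j (ltn_ord j) ji.
    by rewrite -la -lb aj bj; case: (s j).
  by rewrite (_ : Ordinal i5 = j) -?aj ?la ?ji//; apply: val_inj.
(* the direction of the edge in coordinate [i] decides between closure under
   increasing and under decreasing it *)
case si : (s (Ordinal i5)).
  case: ifP => // _; apply/N.eqb_eq/N.bits_inj_0 => z.
  rewrite N.ldiff_spec N.land_spec coord_maskE// !testbit_set_mask.
  apply/negP => /andP[/andP[+ /andP[zp zi]]].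
  case: (N.lt_ge_cases z (2 ^ N.of_nat i)) => [lt|ge]; first by rewrite N.shiftl_spec_low.
  rewrite N.shiftl_spec_high' // testbit_set_mask zp /= => /andP[yp /has_labelP[a [aL Pa la]]].
  move=> /has_labelP nz; have [_ yi yj] := clear_bit zp i5 zi.
  have [b bL lb] := leaf_of_label z.
  have Pb : ~~ P b by apply/negP => Pb; apply: nz; exists b.
  have := lbl _ z a b _ aL bL Pa Pb la lb; rewrite si yi => H.
  by have := H (fun j j5 ji => esym (yj j j5 ji)).
rewrite (_ : down_closed _ _)//; apply/N.eqb_eq/N.bits_inj_0 => y.
rewrite N.ldiff_spec N.shiftr_spec' N.land_spec coord_maskE// !testbit_set_mask.
apply/negP => /andP[/andP[/andP[zp /has_labelP[a [aL Pa la]]] /andP[_ zi]]].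
set z := N.add y _ in zp la zi; have [yp yi yj] := clear_bit zp i5 zi.
have zy : N.sub z (2 ^ N.of_nat i) = y by rewrite N.add_sub.
rewrite zy in yp yi yj; rewrite yp /= => /has_labelP ny.
have [b bL lb] := leaf_of_label y.
have Pb : ~~ P b by apply/negP => Pb; apply: ny; exists b.
by have := lbl z y a b yj aL bL Pa Pb la lb; rewrite si zi.
Qed.

End Masks.

(** * A tree with 32 leaves that needs dimension 6 *)

(** Full binary trees, with their number of vertices. *)
Inductive btree := Leaf | Node of btree & btree.

Fixpoint bsize t := if t is Node l r then (bsize l + bsize r).+1 else 1.

(** The complete binary tree of depth [d]. *)
Fixpoint blob d := if d is d'.+1 then Node (blob d') (blob d') else Leaf.

(** The caterpillar obtained from [t] by grafting successively, above the
    previous root, complete binary trees of the depths [ds]. *)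
Fixpoint spine t ds := if ds is d :: ds' then spine (Node t (blob d)) ds' else t.

(** The parents of the vertices of [t], numbered in preorder from [x] on; [q] is
    the parent of the root of [t]. *)
Fixpoint parents t x q : seq nat :=
  if t is Node l r then q :: parents l x.+1 x ++ parents r (x.+1 + bsize l) x
  else [:: q].

Lemma bsize_gt0 t : 0 < bsize t. Proof. by case: t. Qed.

(** The tree given by [p] on [0], ..., [n], in which binary trees are to be found
    as intervals of the numbering. *)
Section Search.
Variables (n : nat) (p : nat -> nat).
Hypothesis p_lt : forall i, 0 < i -> p i < i.
Let T := parent_tree n p_lt.
Variable lab : T -> 'I_5 -> bool.
Hypothesis sep : separating lab.
Hypothesis t32 : nleaves T = 32.

Definition range x k : pred nat := fun i => x <= i < x + k.

(** Computable versions of being a leaf, and of the following: [range x k] is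
    cut off by the edge above [x]. *)
Definition leafb x : bool :=
  count (fun j => (0 < x) && (p x == j) || (0 < j) && (p j == x)) (iota 0 n.+1)
    == 1.

Definition cutb x k : bool :=
  all (fun i => if range x k i (+) range x k (p i) then i == x else true)
    (iota 1 n).

(** The binary tree [t], numbered in preorder from [x] on, is joined to the
    rest of the tree by at most the edge above [x], and so are its subtrees. *)
Fixpoint placed t x : bool :=
  cutb x (bsize t) &&
  if t is Node l r then [&& ~~ leafb x, placed l x.+1 & placed r (x.+1 + bsize l)]
  else (x <= n) && leafb x.

Definition vrange x k : pred T := fun v : 'I_n.+1 => range x k v.

Lemma leafbE (v : 'I_n.+1) : ((v : T) \in leaves T) = leafb v.
Proof. by rewrite inE /leafb -card_ord_count. Qed.

Lemma cutbP x k : 0 < k -> cutb x k ->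
  is_cut (vrange x k) (inord x : 'I_n.+1) (inord (p x) : 'I_n.+1).
Proof.
move=> k0 /allP H a b ab Sa Sb.
have {}H (i : 'I_n.+1) : 0 < i -> range x k i (+) range x k (p i) -> i = x :> nat.
  move=> i0; have := H i; rewrite mem_iota i0 add1n ltn_ord => /(_ isT).
  by case: ifP => // _ /eqP.
move: ab Sa Sb; rewrite /vrange => /orP[/andP[a0 /eqP pa]|/andP[b0 /eqP pb]] Sa Sb.
  have ax : a = x :> nat by apply: H => //; rewrite pa Sa.
  by split; apply: val_inj; rewrite /= -ax ?pa inordK.
have bx : b = x :> nat by apply: H => //; rewrite pb Sa addbT.
by move: Sb; rewrite /range bx leqnn -[X in X < _]addn0 ltn_add2l k0.
Qed.

(** The label set of the leaves of [t] placed at [x]. *)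
Definition tmask t x := label_mask lab (vrange x (bsize t)).

Lemma unate_tmask t x : placed t x -> unate (tmask t x).
Proof.
move=> tx; have cx : cutb x (bsize t) by case: t tx => [|l r] /andP[].
exact: (unate_label_mask sep t32 (cutbP (bsize_gt0 t) cx)).
Qed.

(** Preorder: the root, then the left subtree, then the right one. *)
Lemma range_Node l r x i : range x (bsize (Node l r)) i =
  [|| i == x, range x.+1 (bsize l) i | range (x.+1 + bsize l) (bsize r) i].
Proof.
rewrite /range /= -addSnnS addnA.
case: (ltngtP i x) => [ix|xi|->] /=.
- by apply/esym/negbTE; rewrite negb_and -ltnNge (leq_trans ix)// addSn leqW// leq_addr.
- case: (ltnP i (x.+1 + bsize l)) => il /=; last by [].
  by rewrite (leq_trans il)// leq_addr.
by rewrite !addSn ltnS -addnA leq_addr.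
Qed.

Lemma placed_leaf t x : placed t x -> exists2 v : T, v \in leaves T & vrange x (bsize t) v.
Proof.
elim: t x => [|l IHl r IHr] x /= /andP[_].
  move=> /andP[xn xL]; exists (inord x : 'I_n.+1).
    by rewrite leafbE inordK.
  by rewrite /vrange /range inordK// leqnn addn1 /=.
move=> /and3P[_ /IHl[v vL vl] _]; exists v => //.
by rewrite /vrange range_Node; apply/or3P; apply: Or32.
Qed.

Lemma tmask_Node l r x : placed (Node l r) x ->
  [/\ tmask (Node l r) x = N.lor (tmask l x.+1) (tmask r (x.+1 + bsize l)),
      N.land (tmask l x.+1) (tmask r (x.+1 + bsize l)) = 0%num &
      tmask l x.+1 <> tmask r (x.+1 + bsize l)].
Proof.
move=> /andP[_ /and3P[xN lx rx]].
have disj : {in leaves T, forall b, vrange x.+1 (bsize l) b ->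
    ~~ vrange (x.+1 + bsize l) (bsize r) b}.
  by move=> b _; rewrite /vrange /range => /andP[_ bl]; rewrite negb_and -ltnNge bl.
split.
- apply: label_maskU => b bL; rewrite /vrange range_Node; case: eqVneq => // bx.
  by rewrite leafbE bx (negPf xN) in bL.
- exact: label_maskI.
have [v vL vl] := placed_leaf lx.
exact: (label_mask_neq sep vL vl disj).
Qed.

Lemma tmask_leaf x : placed Leaf x -> exists a : T, [/\ a \in leaves T, val (a : 'I_n.+1) = x &
  {in leaves T, vrange x 1 =1 pred1 a}].
Proof.
move=> /= /andP[_ /andP[xn xL]]; exists (inord x : 'I_n.+1).
have xE : (inord x : 'I_n.+1) = x :> nat by rewrite inordK.
split=> //; first by rewrite leafbE xE.
move=> b _; rewrite /vrange /range addn1 ltnS -eqn_leq /=.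
by rewrite -(inj_eq val_inj) /= xE eq_sym.
Qed.

Lemma tmask_blob d x : placed (blob d) x -> tmask (blob d) x \in blob_masks d.
Proof.
elim: d x => [|d IHd] x px.
  by have [a [aL _ Pa]] := tmask_leaf px; have [] := label_mask1 lab aL Pa.
have [E I D] := tmask_Node px; have := px => /= /andP[_ /and3P[_ px1 px2]].
rewrite [blob _]/= E; apply: mem_blob_masks => //; [exact: IHd|exact: IHd|].
by rewrite -E; apply: unate_tmask.
Qed.

(** The label sets of the initial parts of a spine pass the search. Each graft
    adds a new root in front, so that [t] starts [size ds] positions after the
    spine. *)
Lemma search_spine tab t ds x : (forall d, d \in ds -> nth [::] tab d = blob_masks d) ->
  placed (spine t ds) x ->
  placed t (x + size ds) /\ search tab (tmask t (x + size ds)) ds.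
Proof.
elim: ds t => [|d ds IHds] t tabE /=; first by rewrite addn0.
move=> /IHds[|]; first by move=> d' d'ds; apply: tabE; rewrite inE d'ds orbT.
move=> px sx; have [E I _] := tmask_Node px.
have := px => /= /andP[_ /and3P[_ pt pd]]; rewrite addnS; split=> //.
apply/hasP; exists (tmask (blob d) ((x + size ds).+1 + bsize t)).
  by rewrite tabE ?mem_head//; apply: tmask_blob.
rewrite I /= -E unate_tmask//.
Qed.

End Search.

(** Flipping coordinates preserves separation. *)
Lemma separating_flip (T : tree) m (lab : T -> 'I_m -> bool) (e : 'I_m -> bool) :
  separating lab -> separating (fun a i => lab a i (+) e i).
Proof.
move=> sep S u v cut; have [s H] := sep S u v cut.
exists (fun i => s i (+) e i) => a b aL bL Sa Sb.
by have [i [la lb]] := H a b aL bL Sa Sb; exists i; rewrite la lb addNb.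
Qed.

(** The depths of the complete binary trees grafted above the first leaf. *)
Definition bad_dims := [:: 2; 3; 2; 3; 0; 0; 0; 0; 0; 0; 0].
Definition bad_shape := spine Leaf bad_dims.
Definition bad_parents := Eval vm_compute in parents bad_shape 0 0.
Definition bad_parent i := nth 0 bad_parents i.

Lemma bad_parent_lt i : 0 < i -> bad_parent i < i.
Proof.
have: all (fun i => bad_parent i < i) (iota 1 62) by vm_compute.
move=> /allP H i0; have [i63|i63] := ltnP i 63; first by apply: H; rewrite mem_iota i0.
by rewrite /bad_parent nth_default.
Qed.

Definition bad_tree : tree := @parent_tree 62 bad_parent bad_parent_lt.

Lemma nleaves_bad : nleaves bad_tree = 32.
Proof.
have : count (leafb 62 bad_parent) (iota 0 63) = 32 by vm_compute.
rewrite -card_ord_count => <-; apply: eq_card => v.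
by rewrite -/(leaves bad_tree) leafbE inE.
Qed.

Lemma bad_placed : placed 62 bad_parent bad_shape 0.
Proof. by vm_compute. Qed.

Lemma bad_not_embeds (R : realType) : ~ linfty_embeds R bad_tree 5.
Proof.
move=> /embeds_separating[lab sep0].
(* 11 grafts put the first leaf of the spine at position 11; its label is made 0
   by flips *)
have [a aL a11] : exists2 a : bad_tree, a \in leaves bad_tree & val (a : 'I_63) = 11.
  exists (inord 11 : 'I_63); last by rewrite /= inordK.
  by rewrite leafbE inordK//; vm_compute.
have sep := separating_flip (lab a) sep0.
set lab' := (fun b i => _) in sep.
have tabE d : d \in bad_dims -> nth [::] blob_table d = blob_masks d.
  move=> dd; apply: nth_blob_table.
  have /allP : all (fun d => d < 4) bad_dims by [].
  exact.
have [pl] := search_spine sep nleaves_bad tabE bad_placed.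
have [b [bL b11 bP]] := tmask_leaf bad_parent_lt pl.
have ba : b = a by apply: val_inj; rewrite [LHS]b11 [RHS]a11.
rewrite /tmask; have [_ ->] := label_mask1 lab' bL bP.
  by rewrite search_fails.
by move=> i; rewrite ba /lab' addbb.
Qed.

(** * The values of D *)

Lemma dim_infty_le (R : realType) (T : tree) m :
  linfty_embeds R T m -> dim_infty R T <= m.
Proof. by move=> /asboolP; rewrite /dim_infty; case: ex_minnP => k _; apply. Qed.

Lemma dim_infty_embeds (R : realType) (T : tree) : linfty_embeds R T (dim_infty R T).
Proof. by rewrite /dim_infty; case: ex_minnP => k /asboolP. Qed.

(* up_log 2 t is the least e with t <= 2 ^ e, i.e. the ceiling of log_2 t *)
Theorem theorem1p2 (R : realType) :
  (forall t : nat, 2 <= t <= 31 -> is_D R t (up_log 2 t)) /\ is_D R 32 6.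
Proof.
have ub t (T : tree) : 2 <= t <= 31 -> nleaves T = t -> dim_infty R T <= up_log 2 t.
  by move=> t31 Tt; apply: dim_infty_le; rewrite -Tt; apply: embeds_up_log; rewrite Tt.
split=> [t t31|].
  split; last by move=> T; apply: ub.
  have st : nleaves (star_tree t) = t by apply: nleaves_star; case/andP: t31.
  exists (star_tree t); split=> //; apply/eqP; rewrite eqn_leq ub//=.
  apply: up_log_min => //; rewrite -[X in X <= _]st.
  exact: nleaves_le_exp (dim_infty_embeds R _).
split; last by move=> T T32; apply/dim_infty_le/embeds32.
exists bad_tree; split; first exact: nleaves_bad.
apply/eqP; rewrite eqn_leq; apply/andP; split; first exact/dim_infty_le/embeds32/nleaves_bad.
(* 32 leaves need dimension at least 5, and 5 is excluded *)
have emb := dim_infty_embeds R bad_tree.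
have d5 : 5 <= dim_infty R bad_tree.
  by have := nleaves_le_exp emb; rewrite nleaves_bad -[32]/(2 ^ 5) leq_exp2l.
rewrite ltn_neqAle d5 andbT; apply/eqP => d5E; rewrite -d5E in emb.
exact: bad_not_embeds emb.
Qed.
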